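(* Let $Q$ be a finite acyclic quiver, $k=\mathbb{C}$, $w:\mathcal{S}_0\to\mathbb{N}$ a dimension vector and $M\in\mathcal{M}_0(w)$. Then the module $K_{LR}(M)$ is both stable and co-stable and thus yields a point $\tilde{M}$ in $\mathcal{M}^{reg}(v,w)$ for a suitable $v$. The unique stratum containing $M$ is $\pi(\mathcal{M}^{reg}(v,w))$, and $\tilde{M}$ is the unique pre-image of $M$ under $\pi:\mathcal{M}^{reg}(v,w)\to\mathcal{M}_0(w)$.
   Context: $k=\mathbb{C}$. Repetition quiver: $\mathbb{Z}Q$ has vertices $(i,p)$, $i\in Q_0$, $p\in\mathbb{Z}$, and for each arrow $\alpha:i\to j$ and $p\in\mathbb{Z}$ arrows $(\alpha,p):(i,p)\to(j,p)$ and $\sigma(\alpha,p):(j,p-1)\to(i,p)$. Put $\tau(i,p)=(i,p-1)$, and for an arrow $\beta$ put $\sigma(\beta)=\sigma(\alpha,p)$ if $\beta=(\alpha,p)$ and $\sigma(\beta)=(\alpha,p-1)$ if $\beta=\sigma(\alpha,p)$. The mesh relator $r_x$ is the sum over all arrows $\beta:y\to x$ of the paths $\tau(x)\xrightarrow{\sigma(\beta)}y\xrightarrow{\beta}x$. Nakajima categories: $\tilde{Q}$ is obtained from $Q$ by adding for each $i\in Q_0$ a new vertex $i'$ and an arrow $i\to i'$. The vertices $(i',p)$ of $\mathbb{Z}\tilde{Q}$ are frozen, the $(i,p)$, $i\in Q_0$, non frozen. For non frozen $x=(i,p)$ put $\sigma(x)=(i',p-1)$. $\mathcal{R}$ has objects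 the vertices of $\mathbb{Z}\tilde{Q}$ and morphisms linear combinations of paths modulo the ideal generated by the $r_x$ for non frozen $x$ only. $\mathcal{S}$ is the full subcategory of $\mathcal{R}$ on the frozen vertices. $\mathcal{R}_0,\mathcal{S}_0$ are the sets of objects. Modules are right modules ($k$-linear contravariant functors to $\mathrm{Mod}\,k$), $S_u$ is the simple module concentrated at $u$. Quiver varieties: dimension vectors are functions with finite support $w:\mathcal{S}_0\to\mathbb{N}$, $v:\mathcal{R}_0\setminus\mathcal{S}_0\to\mathbb{N}$. $\mathcal{M}_0(w)$ is the affine variety of $\mathcal{S}$-modules $M$ with $M(u)=k^{w(u)}$ for $u\in\mathcal{S}_0$. An $\mathcal{R}$-module $M$ (finite-dimensional) is stable if $\mathrm{Hom}_{\mathcal{R}}(S_x,M)=0$, and co-stable if $\mathrm{Hom}_{\mathcal{R}}(M,S_x)=0$, for all non frozen $x$. $\tilde{\mathcal{M}}(v,w)$ is the set of stable $\mathcal{R}$-modules $M$ with $M(x)=k^{v(x)}$, $M(\sigma(x))=k^{w(\sigma(x))}$ for $x\in\mathbb{Z}Q_0$. $G_v=\prod_x GL(k^{v(x)})$ acts freely on it by base change, and $\mathcal{M}(v,w)=\tilde{\mathcal{M}}(v,w)/G_v$, a smooth quasi-projective variety. Restriction to $\mathcal{S}$ gives a proper map $\pi:\mathcal{M}(v,w)\to\mathcal{M}_0(w)$. $\mathcal{M}^{reg}(v,w)\subset\mathcal{M}(v,w)$ is the open subset of classes of modules that are moreover co-stable. The strata of $\mathcal{M}_0(w)$ are the non empty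 images $\pi(\mathcal{M}^{reg}(v,w))$ as $v$ varies; it is known that they stratify (partition) $\mathcal{M}_0(w)$ and that $\pi$ induces an isomorphism from each $\mathcal{M}^{reg}(v,w)$ onto its image. Kan extensions: $K_L$ and $K_R$ are the left and right adjoints of the restriction functor $\mathrm{res}:\mathrm{Mod}(\mathcal{R})\to\mathrm{Mod}(\mathcal{S})$; both are fully faithful, there is a canonical morphism $K_L\to K_R$ (restricting to the identity), and the intermediate Kan extension $K_{LR}(M)$ is the image of $K_L(M)\to K_R(M)$. *)

(* Defs.v *)
From HB Require Import structures.
From mathcomp Require Import all_boot all_order all_algebra.
From mathcomp Require Import finmap ring_quotient generic_quotient.
From mathcomp Require Import monalg.
From mathcomp Require Import boolp classical_sets reals.
From mathcomp Require Import complex.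

Set Implicit Arguments.
Unset Strict Implicit.
Unset Printing Implicit Defensive.

Import GRing.Theory.

Local Open Scope ring_scope.
Local Open Scope quotient_scope.

Record category := Category {
  obj :> Type;
  mor : obj -> obj -> Type;
  mid : forall x, mor x x;
  mcomp : forall x y z, mor y z -> mor x y -> mor x z;
  mcompA : forall x y z t (h : mor z t) (g : mor y z) (f : mor x y),
    mcomp h (mcomp g f) = mcomp (mcomp h g) f;
  mcomp1l : forall x y (f : mor x y), mcomp (mid y) f = f;
  mcomp1r : forall x y (f : mor x y), mcomp f (mid x) = f }.

Arguments mor {c}.
Arguments mid {c}.

Record functor (C D : category) := Functor {
  fobj :> C -> D;
  fmor : forall x y, mor x y -> mor (fobj x) (fobj y);
  fmor1 : forall x, fmor (mid x) = mid (fobj x);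
  fmorM : forall x y z (g : mor y z) (f : mor x y),
    fmor (mcomp g f) = mcomp (fmor g) (fmor f) }.

(** [adjunction F G]: [F] is left adjoint to [G]. *)
Record adjunction (C D : category) (F : functor C D) (G : functor D C) :=
  Adjunction {
    adj : forall x y, mor (F x) y -> mor x (G y);
    adjV : forall x y, mor x (G y) -> mor (F x) y;
    adjK : forall x y, cancel (@adj x y) (@adjV x y);
    adjVK : forall x y, cancel (@adjV x y) (@adj x y);
    adj_natl : forall x x' y (f : mor x' x) (h : mor (F x) y),
      adj (mcomp h (fmor F f)) = mcomp (adj h) f;
    adj_natr : forall x y y' (g : mor y y') (h : mor (F x) y),
      adj (mcomp g h) = mcomp (fmor G g) (adj h) }.

Definition adj_unit C D (F : functor C D) (G : functor D C)
  (a : adjunction F G) (x : C) : mor x (G (F x)) := adj a (mid (F x)).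

Definition adj_counit C D (F : functor C D) (G : functor D C)
  (a : adjunction F G) (y : D) : mor (F (G y)) y := adjV a (mid (G y)).

(** Composition is written in the order of paths: [lcomp f g] is
    [f] followed by [g]. *)
Record lincat (k : fieldType) := LinCat {
  lob :> Type;
  hom : lob -> lob -> lmodType k;
  lid : forall x, hom x x;
  lcomp : forall x y z, hom x y -> hom y z -> hom x z;
  lcomp_linl : forall x y z (g : hom y z),
    linear (fun f : hom x y => lcomp f g);
  lcomp_linr : forall x y z (f : hom x y),
    linear (fun g : hom y z => lcomp f g);
  lcompA : forall x y z t (f : hom x y) (g : hom y z) (h : hom z t),
    lcomp f (lcomp g h) = lcomp (lcomp f g) h;
  lcomp1l : forall x y (f : hom x y), lcomp (lid x) f = f;
  lcomp1r : forall x y (f : hom x y), lcomp f (lid y) = f }.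

Arguments hom {k l}.
Arguments lid {k l}.

(** The structure of a right module (contravariant k-linear functor) on a
    prescribed family of values. *)
Record mod_on (k : fieldType) (C : lincat k) (V : C -> lmodType k) := ModOn {
  act : forall x y, hom x y -> V y -> V x;
  act_linl : forall x y (m : V y), linear (fun f : hom x y => act f m);
  act_linr : forall x y (f : hom x y), linear (act f);
  act1 : forall x (m : V x), act (lid x) m = m;
  actM : forall x y z (f : hom x y) (g : hom y z) (m : V z),
    act (lcomp f g) m = act f (act g m) }.

Record module (k : fieldType) (C : lincat k) := Module {
  carrier :> C -> lmodType k;
  structure :> mod_on carrier }.

Record mod_hom (k : fieldType) (C : lincat k) (M N : module C) := ModHom {
  mfun :> forall x, M x -> N x;
  mfun_linear : forall x, linear (@mfun x);
  mfun_nat : forall x y (f : hom x y) (m : M y),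
    mfun (act M f m) = act N f (mfun m) }.

Arguments mfun {k C M N} _ x _.
Arguments mfun_linear {k C M N} _ x.

HB.instance Definition _ (k : fieldType) (C : lincat k) (M N : module C)
    (f : mod_hom M N) (x : C) :=
  GRing.isLinear.Build k (M x) (N x) *:%R (mfun f x)
    (mfun_linear f x).

Lemma act0l (k : fieldType) (C : lincat k) (V : C -> lmodType k)
  (N : mod_on V) (x y : C) (m : V y) : act N (0 : hom x y) m = 0.
Proof.
have := act_linl N m (-1) (0 : hom x y) 0.
by rewrite [-1 *: (0 : hom x y)]scaler0 addr0 [-1 *: act _ _ _]scaleN1r addNr.
Qed.

Lemma act0r (k : fieldType) (C : lincat k) (V : C -> lmodType k)
  (N : mod_on V) (x y : C) (f : hom x y) : act N f 0 = 0.
Proof.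
have := act_linr N f (-1) 0 0.
by rewrite [-1 *: (0 : V y)]scaler0 addr0 [-1 *: act _ _ _]scaleN1r addNr.
Qed.

Section ModuleCategory.
Variables (k : fieldType) (C : lincat k).
Implicit Types M N P : module C.

Lemma mod_on_eq (V : C -> lmodType k) (A B : mod_on V) :
  (forall x y (f : hom x y) m, act A f m = act B f m) -> A = B.
Proof.
case: A B => [a a1 a2 a3 a4] [b b1 b2 b3 b4] /= e.
have {}e : a = b.
  apply: functional_extensionality_dep => x.
  apply: functional_extensionality_dep => y.
  apply: functional_extensionality_dep => f.
  by apply: functional_extensionality_dep => m; apply: e.
subst b.
by rewrite (Prop_irrelevance a1 b1) (Prop_irrelevance a2 b2)
  (Prop_irrelevance a3 b3) (Prop_irrelevance a4 b4).
Qed.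

Lemma mod_hom_eq M N (f g : mod_hom M N) :
  (forall x (m : M x), f x m = g x m) -> f = g.
Proof.
case: f g => [f f1 f2] [g g1 g2] /= e.
have {}e : f = g.
  apply: functional_extensionality_dep => x.
  by apply: functional_extensionality_dep => m; apply: e.
by subst g; rewrite (Prop_irrelevance f1 g1) (Prop_irrelevance f2 g2).
Qed.

Definition mod_id M : mod_hom M M.
Proof. by exists (fun x m => m). Defined.

Definition mod_comp M N P (g : mod_hom N P) (f : mod_hom M N) : mod_hom M P.
Proof.
exists (fun x m => g x (f x m)) => [x a u v|x y h m].
  by rewrite !linearP.
by rewrite !mfun_nat.
Defined.

Definition mod_zero M N : mod_hom M N.
Proof.
exists (fun x _ => 0) => [x a u v|x y f m]; first by rewrite scaler0 addr0.
by rewrite act0r.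
Defined.

Definition Mod : category.
Proof.
by exists (module C) (@mod_hom k C) mod_id mod_comp => *; apply: mod_hom_eq.
Defined.

Definition is_iso M N (f : mod_hom M N) : Prop := forall x, bijective (f x).

End ModuleCategory.

Section LinearImage.
Variables (k : fieldType) (U V : lmodType k) (f : {linear U -> V}).

Definition limg_pred : {pred V} := fun v => `[< exists u, f u = v >].

Lemma limg_submod_closed : submod_closed limg_pred.
Proof.
split; first by apply/asboolP; exists 0; rewrite linear0.
move=> a u v /asboolP[u' <-] /asboolP[v' <-].
by apply/asboolP; exists (a *: u' + v'); rewrite linearP.
Qed.

HB.instance Definition _ :=
  GRing.isSubmodClosed.Build k V limg_pred limg_submod_closed.

Record limg := LImg { limg_val : V; limgP : limg_val \in limg_pred }.
HB.instance Definition _ := [isSub for limg_val].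
HB.instance Definition _ := [Choice of limg by <:].
HB.instance Definition _ := [SubChoice_isSubLmodule of limg by <:].

Lemma limg_mem u : f u \in limg_pred.
Proof. by apply/asboolP; exists u. Qed.

End LinearImage.

Section Image.
Variables (k : fieldType) (C : lincat k) (M N : module C) (c : mod_hom M N).

Lemma image_act_mem x y (f : hom x y) (n : limg (c y)) :
  act N f (val n) \in limg_pred (c x).
Proof.
by case: n => n /= /asboolP[m <-]; apply/asboolP; exists (act M f m);
  apply: mfun_nat.
Qed.

Definition image_mod : module C.
Proof.
exists (fun x => limg (c x)).
exists (fun x y f n => LImg (image_act_mem f n)).
- by move=> x y m a f g; apply: val_inj; rewrite /= act_linl.
- by move=> x y f a m n; apply: val_inj; rewrite /= act_linr.
- by move=> x m; apply: val_inj; rewrite /= act1.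
- by move=> x y z f g m; apply: val_inj; rewrite /= actM.
Defined.

Definition image_proj : mod_hom M image_mod.
Proof.
exists (fun x m => LImg (limg_mem (c x) m) : limg (c x)).
- by move=> x a u v; apply: val_inj; apply: mfun_linear.
- by move=> x y f m; apply: val_inj; apply: mfun_nat.
Defined.

End Image.

Section FullSubcategory.
Variables (k : fieldType) (C : lincat k) (I : Type) (e : I -> C).

Definition full_subcat : lincat k.
Proof.
exists I (fun u v => hom (e u) (e v)) (fun u => lid (e u))
  (fun x y z f g => lcomp f g).
- by move=> *; apply: lcomp_linl.
- by move=> *; apply: lcomp_linr.
- by move=> *; apply: lcompA.
- by move=> *; apply: lcomp1l.
- by move=> *; apply: lcomp1r.
Defined.

Definition res_on (V : C -> lmodType k) (N : mod_on V) :
  @mod_on k full_subcat (fun u => V (e u)).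
Proof.
exists (fun x y f m => act N (f : hom (e x) (e y)) m).
- by move=> x y m; apply: (@act_linl _ _ _ N (e x) (e y) m).
- by move=> x y f; apply: (@act_linr _ _ _ N (e x) (e y) f).
- by move=> x m; apply: (act1 N).
- by move=> x y z f g m; apply: (actM N).
Defined.

Definition res_mod (N : module C) : module full_subcat := Module (res_on N).

Definition res_hom (M N : module C) (f : mod_hom M N) :
  mod_hom (res_mod M) (res_mod N).
Proof.
exists (fun u m => f (e u) m) => [u|u v h m].
  exact: (mfun_linear f (e u)).
exact: (mfun_nat f).
Defined.

Definition res : functor (Mod C) (Mod full_subcat).
Proof.
by exists (res_mod : Mod C -> Mod full_subcat) res_hom => *; apply: mod_hom_eq.
Defined.

End FullSubcategory.

Section LinearQuotient.
Variables (k : fieldType) (V : lmodType k) (I : submodClosed V).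

Definition lquot_pred : {pred V} := fun v => v \in I.

Lemma lquot_zmod_closed : zmod_closed lquot_pred.
Proof.
split=> [|u v hu hv]; first exact: rpred0.
by rewrite unfold_in -[- v]scaleN1r; apply: rpredD => //; apply: rpredZ.
Qed.

HB.instance Definition _ :=
  GRing.isZmodClosed.Build V lquot_pred lquot_zmod_closed.

Definition lquot := {ideal_quot lquot_pred}.
HB.instance Definition _ := GRing.Zmodule.on lquot.
HB.instance Definition _ := EqQuotient.on lquot.

Definition lquot_scale (a : k) (u : lquot) : lquot := \pi_lquot (a *: repr u).

Lemma lquot_eqP (u v : V) : (\pi_lquot u = \pi_lquot v) <-> (u - v \in I).
Proof.
have e := Quotient.idealrBE lquot_pred u v.
by split=> [h|h]; [move: e; rewrite h eqxx | apply/eqP; rewrite -e].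
Qed.

Lemma lquot_piD (u v : V) : \pi_lquot (u + v) = \pi_lquot u + \pi_lquot v.
Proof. exact: (raddfD (\pi_{ideal_quot lquot_pred})). Qed.

Lemma lquot_piZ (a : k) (u : V) :
  \pi_lquot (a *: u) = lquot_scale a (\pi_lquot u).
Proof.
apply/lquot_eqP; rewrite -scalerBr; apply: rpredZ; apply/lquot_eqP.
by rewrite reprK.
Qed.

Lemma lquot_scaleA a b u :
  lquot_scale a (lquot_scale b u) = lquot_scale (a * b) u.
Proof.
by elim/quotW: u => u; rewrite -(lquot_piZ b u) -!lquot_piZ scalerA.
Qed.

Lemma lquot_scale1 : left_id 1 lquot_scale.
Proof. by elim/quotW => u; rewrite -lquot_piZ scale1r. Qed.

Lemma lquot_scaleDr : right_distributive lquot_scale +%R.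
Proof.
move=> a; elim/quotW => u; elim/quotW => v.
by rewrite -lquot_piD -(lquot_piZ a u) -(lquot_piZ a v) -lquot_piZ scalerDr
  lquot_piD.
Qed.

Lemma lquot_scaleDl v :
  {morph (lquot_scale^~ v) : a b / a + b >-> a + b}.
Proof.
by elim/quotW: v => v a b; rewrite /= -!(lquot_piZ _ v) scalerDl lquot_piD.
Qed.

HB.instance Definition _ := GRing.Zmodule_isLmodule.Build k lquot
  lquot_scaleA lquot_scale1 lquot_scaleDr lquot_scaleDl.

Lemma lquot_pi_linear : linear (\pi_lquot : V -> lquot).
Proof. by move=> a u v; rewrite lquot_piD lquot_piZ. Qed.

Lemma lquot_reprP (u : V) : repr (\pi_lquot u) - u \in I.
Proof. by apply/lquot_eqP; rewrite reprK. Qed.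

End LinearQuotient.

Section QuotientCategory.
Variables (k : fieldType) (C : lincat k).

Lemma lcompBl x y z (f f' : hom x y) (g : hom y z) :
  @lcomp k C x y z (f - f') g = lcomp f g - lcomp f' g.
Proof.
by have := lcomp_linl g (-1) f' f; rewrite !scaleN1r [- f' + _]addrC
  [- _ + _]addrC.
Qed.

Lemma lcompBr x y z (f : hom x y) (g g' : hom y z) :
  @lcomp k C x y z f (g - g') = lcomp f g - lcomp f g'.
Proof.
by have := lcomp_linr f (-1) g' g; rewrite !scaleN1r [- g' + _]addrC
  [- _ + _]addrC.
Qed.

Variable (G : forall x y : C, hom x y -> Prop).

Inductive ideal_gen : forall x y : C, hom x y -> Prop :=
| ideal_in x y (f : hom x y) : G f -> ideal_gen f
| ideal_0 x y : @ideal_gen x y 0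
| ideal_lin x y a (f g : hom x y) :
    ideal_gen f -> ideal_gen g -> ideal_gen (a *: f + g)
| ideal_compl x y z (f : hom x y) (g : hom y z) :
    ideal_gen g -> ideal_gen (lcomp f g)
| ideal_compr x y z (f : hom x y) (g : hom y z) :
    ideal_gen f -> ideal_gen (lcomp f g).

Definition ideal_pred (x y : C) : {pred (hom x y : lmodType k)} :=
  fun f => `[< ideal_gen f >].
Local Arguments ideal_pred x y : clear implicits.

Lemma ideal_submod_closed x y : submod_closed (ideal_pred x y).
Proof.
split; first by apply/asboolP; apply: ideal_0.
by move=> a f g /asboolP hf /asboolP hg; apply/asboolP; apply: ideal_lin.
Qed.

HB.instance Definition _ x y := GRing.isSubmodClosed.Build k (hom x y)
  (ideal_pred x y) (ideal_submod_closed x y).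

Definition qhom (x y : C) : lmodType k := lquot (ideal_pred x y).

Definition qpi x y (f : hom x y) : qhom x y := \pi_(lquot (ideal_pred x y)) f.
Definition qrepr x y (f : qhom x y) : hom x y :=
  repr (f : lquot (ideal_pred x y)).

Lemma qreprK x y : cancel (@qrepr x y) (@qpi x y).
Proof. exact: reprK. Qed.

Lemma qpi_eq x y (f g : hom x y) : qpi f = qpi g <-> ideal_gen (f - g).
Proof.
split=> [/lquot_eqP /asboolP //|h]; apply/lquot_eqP; exact/asboolP.
Qed.

Lemma qpi_linear x y : linear (@qpi x y).
Proof. exact: lquot_pi_linear. Qed.

Definition qcomp x y z (f : qhom x y) (g : qhom y z) : qhom x z :=
  qpi (lcomp (qrepr f) (qrepr g)).

Lemma qcomp_pi x y z (f : hom x y) (g : hom y z) :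
  qcomp (qpi f) (qpi g) = qpi (lcomp f g).
Proof.
rewrite /qcomp; set f' := qrepr _; set g' := qrepr _.
have hf : ideal_gen (f' - f) by apply/qpi_eq; rewrite qreprK.
have hg : ideal_gen (g' - g) by apply/qpi_eq; rewrite qreprK.
apply/qpi_eq.
have -> : lcomp f' g' - lcomp f g =
      1 *: @lcomp k C x y z f' (g' - g) + @lcomp k C x y z (f' - f) g.
  by rewrite scale1r lcompBl lcompBr addrA subrK.
by apply: ideal_lin; [apply: ideal_compl | apply: ideal_compr].
Qed.

Lemma qpiW x y (P : qhom x y -> Prop) : (forall f, P (qpi f)) -> forall f, P f.
Proof. by move=> h f; rewrite -[f]qreprK. Qed.

Definition quot_cat : lincat k.
Proof.
exists C qhom (fun x => qpi (lid x)) qcomp.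
- move=> x y z; elim/qpiW => g a; elim/qpiW => f; elim/qpiW => f'.
  by rewrite -qpi_linear !qcomp_pi lcomp_linl qpi_linear.
- move=> x y z; elim/qpiW => f a; elim/qpiW => g; elim/qpiW => g'.
  by rewrite -qpi_linear !qcomp_pi lcomp_linr qpi_linear.
- move=> x y z t; elim/qpiW => f; elim/qpiW => g; elim/qpiW => h.
  by rewrite !qcomp_pi lcompA.
- by move=> x y; elim/qpiW => f; rewrite qcomp_pi lcomp1l.
- by move=> x y; elim/qpiW => f; rewrite qcomp_pi lcomp1r.
Defined.

(** A module over [C] on which the generators act by zero is a module over the
    quotient. *)
Section QuotientModule.
Variables (V : C -> lmodType k) (N : mod_on V).
Hypothesis N0 : forall x y (f : hom x y), G f -> forall m, act N f m = 0.

Lemma ideal_gen_act0 x y (f : hom x y) : ideal_gen f ->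
  forall m, act N f m = 0.
Proof.
elim=> {x y f} [x y f /N0 //|x y m|x y a f g _ hf _ hg m|x y z f g _ hg m|
  x y z f g _ hf m].
- by rewrite act0l.
- by rewrite (act_linl N m) hf hg scaler0 addr0.
- by rewrite actM hg act0r.
- by rewrite actM hf.
Qed.

Lemma act_qrepr x y (f : hom x y) m : act N (qrepr (qpi f)) m = act N f m.
Proof.
have /ideal_gen_act0/(_ m) : ideal_gen (qrepr (qpi f) - f).
  by apply/qpi_eq; rewrite qreprK.
have -> : qrepr (qpi f) - f = -1 *: f + qrepr (qpi f).
  by rewrite scaleN1r addrC.
by rewrite (act_linl N m) scaleN1r addrC => /subr0_eq.
Qed.

Definition quot_mod_on : @mod_on k quot_cat V.
Proof.
apply: (@ModOn k quot_cat V (fun x y (f : qhom x y) m => act N (qrepr f) m)).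
- move=> x y m a; elim/qpiW => f; elim/qpiW => g.
  by rewrite -qpi_linear !act_qrepr (act_linl N m).
- by move=> x y f; apply: (act_linr N).
- by move=> x m; rewrite act_qrepr act1.
- move=> x y z; elim/qpiW => f; elim/qpiW => g m.
  by rewrite [lcomp _ _]qcomp_pi !act_qrepr actM.
Defined.

End QuotientModule.

End QuotientCategory.

Record quiver (V A : Type) := Quiver { src : A -> V; tgt : A -> V }.

(** [is_path Q x s y]: the arrows of [s], in this order, form a path from [x]
    to [y]; [[::]] is the trivial path. *)
Fixpoint is_path (V : eqType) (A : Type) (Q : quiver V A) (x : V) (s : seq A)
  (y : V) : bool :=
  if s is a :: s' then (src Q a == x) && is_path Q (tgt Q a) s' y else x == y.

Definition acyclic (V : eqType) (A : Type) (Q : quiver V A) : Prop :=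
  forall (x : V) (s : seq A), is_path Q x s x -> s = [::].

Section PathCategory.
Variables (k : fieldType) (V A : choiceType) (Q : quiver V A).

Record qpath (x y : V) := QPath {
  arrows : seq A;
  qpathP : is_path Q x arrows y }.

HB.instance Definition _ x y := [isSub for @arrows x y].
HB.instance Definition _ x y := [Choice of qpath x y by <:].

Lemma is_path_cat x y z s t :
  is_path Q x s y -> is_path Q y t z -> is_path Q x (s ++ t) z.
Proof.
elim: s x => [|a s IH] x /=; first by move/eqP->.
by case/andP=> -> /IH h /h.
Qed.

Definition path_nil x : qpath x x := @QPath x x [::] (eqxx x).
Definition path_cat x y z (p : qpath x y) (q : qpath y z) : qpath x z :=
  QPath (is_path_cat (qpathP p) (qpathP q)).

Definition phom (x y : V) : lmodType k := {malg k[qpath x y]}.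

Definition pext x y (W : lmodType k) (h : qpath x y -> W) (f : phom x y) : W :=
  \sum_(p <- msupp f) f@_p *: h p.

Lemma pextwE x y (W : lmodType k) (h : qpath x y -> W) (f : phom x y)
    (d : {fset qpath x y}) :
  (msupp f `<=` d)%fset -> pext h f = \sum_(p <- d) f@_p *: h p.
Proof.
move=> sd; rewrite /pext (big_fset_incl _ sd) // => p _ /mcoeff_outdom ->.
by rewrite scale0r.
Qed.

Lemma pext_linear x y (W : lmodType k) (h : qpath x y -> W) :
  linear (pext h).
Proof.
move=> a f g; pose d := (msupp f `|` msupp g `|` msupp (a *: f + g))%fset.
rewrite (@pextwE _ _ _ h f d) ?(@pextwE _ _ _ h g d) ?(@pextwE _ _ _ h _ d).
- rewrite scaler_sumr -big_split; apply: eq_bigr => p _ /=.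
  by rewrite mcoeffD mcoeffZ scalerDl scalerA.
- by rewrite fsubsetUr.
- by rewrite /d -fsetUA fsetUCA fsubsetUl.
- by rewrite /d -fsetUA fsubsetUl.
Qed.

HB.instance Definition _ x y (W : lmodType k) (h : qpath x y -> W) :=
  GRing.isLinear.Build k (phom x y) W *:%R (pext h) (pext_linear h).

Lemma pextU x y (W : lmodType k) (h : qpath x y -> W) p :
  pext h (<< p >> : phom x y) = h p.
Proof.
rewrite (pextwE _ (@msuppU_le _ k p 1)) big_seq_fset1 mcoeffUU scale1r //.
Qed.

Lemma pext_comb x y (W : lmodType k) (h : qpath x y -> W) (a : k)
    (h1 h2 : qpath x y -> W) f :
  (forall p, h p = a *: h1 p + h2 p) -> pext h f = a *: pext h1 f + pext h2 f.
Proof.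
move=> e; rewrite /pext scaler_sumr -big_split; apply: eq_bigr => p _ /=.
by rewrite e scalerDr !scalerA mulrC.
Qed.

Lemma phom_ext x y (W : lmodType k) (F F' : phom x y -> W) :
  linear F -> linear F' -> (forall p, F << p >> = F' << p >>) -> F =1 F'.
Proof.
move=> lF lF' e f.
pose F1 : {linear phom x y -> W} :=
  HB.pack F (GRing.isLinear.Build _ _ _ _ F lF).
pose F2 : {linear phom x y -> W} :=
  HB.pack F' (GRing.isLinear.Build _ _ _ _ F' lF').
change (F1 f = F2 f); rewrite [f]monalgE !linear_sum; apply: eq_bigr => p _.
have -> : << f@_p *g p >> = f@_p *: (<< p >> : phom x y).
  by apply/malgP => q; rewrite mcoeffZ !mcoeffU mulrnAr mulr1.
by rewrite !linearZ /= e.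
Qed.

Definition pcomp x y z (f : phom x y) (g : phom y z) : phom x z :=
  pext (fun p => pext (fun q => << path_cat p q >> : phom x z) g) f.

Lemma pcompU x y z (p : qpath x y) (q : qpath y z) :
  pcomp << p >> << q >> = << path_cat p q >>.
Proof. by rewrite /pcomp !pextU. Qed.

Lemma pcomp_linl x y z (g : phom y z) :
  linear (fun f : phom x y => pcomp f g).
Proof. exact: pext_linear. Qed.

Lemma pcomp_linr x y z (f : phom x y) :
  linear (fun g : phom y z => pcomp f g).
Proof. by move=> a g g'; apply: pext_comb => p; rewrite linearP. Qed.

Definition path_lincat : lincat k.
Proof.
exists V phom (fun x => << path_nil x >>) pcomp.
- exact: pcomp_linl.
- exact: pcomp_linr.
- move=> x y z t f g h; move: f; apply: phom_ext.
  + exact: pcomp_linl.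
  + by move=> a f f'; rewrite !pcomp_linl.
  move=> p; move: g; apply: phom_ext.
  + by move=> a g g'; rewrite pcomp_linl pcomp_linr.
  + by move=> a g g'; rewrite pcomp_linr pcomp_linl.
  move=> q; move: h; apply: phom_ext.
  + by move=> a h h'; rewrite !pcomp_linr.
  + exact: pcomp_linr.
  move=> r; rewrite !pcompU; congr << _ >>; apply: val_inj.
  exact: catA.
- move=> x y; apply: phom_ext => [|//|p]; first exact: pcomp_linr.
  by rewrite pcompU; congr << _ >>; apply: val_inj.
- move=> x y; apply: phom_ext => [|//|p]; first exact: pcomp_linl.
  by rewrite pcompU; congr << _ >>; apply: val_inj; apply: cats0.
Defined.

(** The basis vector of [s] if [s] is a path from [x] to [y], and [0]
    otherwise. *)
Definition pathvec (x y : V) (s : seq A) : phom x y :=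
  if insub s is Some p then << p >> else 0.

End PathCategory.

#[projections(primitive)]
Record rvertex (V : Type) := RVertex { base : V; level : int }.

Section RVertex.
Variable V : choiceType.
Definition rvertex_pair (x : rvertex V) : V * int := (base x, level x).
Definition pair_rvertex (x : V * int) : rvertex V := RVertex x.1 x.2.
Lemma rvertex_pairK : cancel rvertex_pair pair_rvertex. Proof. by []. Qed.
HB.instance Definition _ := Choice.copy (rvertex V) (can_type rvertex_pairK).
End RVertex.

(** [inl (a, p)] is the arrow [(a, p)], and [inr (a, p)] is [sigma(a, p)]. *)
Definition rarrow (A : Type) : Type := A * int + A * int.
HB.instance Definition _ (A : choiceType) := Choice.on (rarrow A).

Section Repetition.
Variables (V A : Type) (Q : quiver V A).

Definition repetition : quiver (rvertex V) (rarrow A) :=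
  Quiver
    (fun b => match b with
              | inl (a, p) => RVertex (src Q a) p
              | inr (a, p) => RVertex (tgt Q a) (p - 1)
              end)
    (fun b => match b with
              | inl (a, p) => RVertex (tgt Q a) p
              | inr (a, p) => RVertex (src Q a) p
              end).

Definition tau (x : rvertex V) : rvertex V := RVertex (base x) (level x - 1).

Definition sigma (b : rarrow A) : rarrow A :=
  match b with
  | inl (a, p) => inr (a, p)
  | inr (a, p) => inl (a, p - 1)
  end.

Definition rarrow_at (p : int) (c : A + A) : rarrow A :=
  match c with inl a => inl (a, p) | inr a => inr (a, p) end.

Lemma sigma_path (b : rarrow A) :
  [/\ src repetition (sigma b) = tau (tgt repetition b)
    & tgt repetition (sigma b) = src repetition b].
Proof. by case: b => [[a p]|[a p]]. Qed.

(** All arrows with target [x] have the level of [x], so that the sum in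
    [mesh_relator] below runs over all of them. *)
Lemma rarrow_atP (b : rarrow A) :
  exists c, b = rarrow_at (level (tgt repetition b)) c.
Proof. by case: b => [[a p]|[a p]]; [exists (inl a)|exists (inr a)]. Qed.

End Repetition.

Definition mesh_relator (k : fieldType) (V A : finType) (Q : quiver V A)
    (x : rvertex V) : phom k (repetition Q) (tau x) x :=
  \sum_(c : A + A | tgt (repetition Q) (rarrow_at (level x) c) == x)
    pathvec k (repetition Q) (tau x) x
      [:: sigma (rarrow_at (level x) c); rarrow_at (level x) c].

(** The framed quiver: [inr i] is the new vertex [i'], and [inr i] is also the
    new arrow from [i] to [i']. *)
Definition framed (V A : Type) (Q : quiver V A) : quiver (V + V) (A + V) :=
  Quiver
    (fun a => match a with inl a => inl (src Q a) | inr i => inl i end)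
    (fun a => match a with inl a => inl (tgt Q a) | inr i => inr i end).

Section Nakajima.
Variables (k : fieldType) (Q0 Q1 : finType) (Q : quiver Q0 Q1).

Definition ZQt := repetition (framed Q).

(** [(i, p)] and [(i', p)], as vertices of the repetition of the framed
    quiver. *)
Definition nonfrozen (x : rvertex Q0) : rvertex (Q0 + Q0)%type :=
  RVertex (inl (base x)) (level x).
Definition frozen (u : rvertex Q0) : rvertex (Q0 + Q0)%type :=
  RVertex (inr (base u)) (level u).

Inductive mesh_relation :
  forall x y : path_lincat k ZQt, hom x y -> Prop :=
| MeshRelation (x : rvertex Q0) :
    @mesh_relation (tau (nonfrozen x)) (nonfrozen x)
      (mesh_relator k (framed Q) (nonfrozen x)).

Definition RNak : lincat k := quot_cat mesh_relation.

Definition SNak : lincat k := @full_subcat k RNak (rvertex Q0) frozen.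

Definition resRS : functor (Mod RNak) (Mod SNak) :=
  @res k RNak (rvertex Q0) frozen.

(** The coefficient of the trivial path. *)
Definition aug x y (f : phom k ZQt x y) : k :=
  pext (fun p : qpath ZQt x y => (nilp (arrows p))%:R : k^o) f.

Lemma aug_linear x y : linear (@aug x y : phom k ZQt x y -> k^o).
Proof. exact: pext_linear. Qed.

Lemma aug_comp x y z (f : phom k ZQt x y) (g : phom k ZQt y z) :
  aug (pcomp f g) = aug f * aug g.
Proof.
move: f; apply: (@phom_ext _ _ _ _ _ _ k^o).
- by move=> a f f'; rewrite pcomp_linl aug_linear.
- move=> a f f'; rewrite (aug_linear a f f') mulrDl.
  by congr (_ + _); rewrite [LHS]mulrC mulrCA [aug g * _]mulrC.
move=> p; move: g; apply: (@phom_ext _ _ _ _ _ _ k^o).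
- by move=> a g g'; rewrite pcomp_linr aug_linear.
- move=> a g g'; rewrite (aug_linear a g g') mulrDr.
  by congr (_ + _); rewrite mulrCA.
move=> q; rewrite pcompU /aug !pextU /= -natrM mulnb.
by case: (arrows p) (arrows q) => [|? ?] [].
Qed.

Lemma aug_neq0 x y (f : phom k ZQt x y) : aug f != 0 -> x = y.
Proof.
move=> h; apply/eqP; apply: contraNT h => nxy.
rewrite /aug /pext big1 // => p _.
case: p => -[|a s] hp /=; last by rewrite scaler0.
by case/negP: nxy.
Qed.

Lemma aug_mesh x y (f : phom k ZQt x y) : mesh_relation f -> aug f = 0.
Proof.
case=> {x y f} x; rewrite /mesh_relator.
elim/big_rec: _ => [|c f _ hf]; first by rewrite /aug linear0.
rewrite -[X in X + f]scale1r aug_linear hf addr0 scale1r /aug /pathvec.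
by case: insubP => [p _ e|_]; rewrite ?linear0 // pextU e.
Qed.

Definition simple_path_mod_on (u : rvertex (Q0 + Q0)%type) :
  @mod_on k (path_lincat k ZQt) (fun x => 'rV[k]_(x == u)).
Proof.
apply: (@ModOn k (path_lincat k ZQt) (fun x => 'rV[k]_(x == u))
  (fun x y (f : phom k ZQt x y) m => aug f *: (m *m pid_mx 1))).
- by move=> x y m a f g; rewrite [aug _]aug_linear scalerDl scalerA.
- by move=> x y f a m n; rewrite mulmxDl -scalemxAl scalerDr !scalerA mulrC.
- move=> x m; rewrite /aug pextU /= scale1r.
  by case: (x == u) m => m; rewrite ?pid_mx_1 ?mulmx1 // !thinmx0.
- move=> x y z f g m; rewrite [aug _]aug_comp.
  have [->|f0] := eqVneq (aug f) 0; first by rewrite mul0r !scale0r.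
  have [->|g0] := eqVneq (aug g) 0.
    by rewrite mulr0 !scale0r mul0mx scaler0.
  move: (aug_neq0 f0) (aug_neq0 g0) => exy eyz; subst y z.
  rewrite -scalerA -scalemxAl; congr (_ *: (_ *: _)).
  by case: (x == u) m => m; rewrite ?pid_mx_1 ?mulmx1 // !thinmx0.
Defined.

Lemma simple_path_mesh u (x y : path_lincat k ZQt) (f : hom x y) :
  mesh_relation f -> forall m, act (simple_path_mod_on u) f m = 0.
Proof. by move/aug_mesh => h m /=; rewrite h scale0r. Qed.

(** The simple module [S_u]: it is [k] at [u] and zero elsewhere, and all non
    trivial paths act by zero. *)
Definition simple_mod (u : rvertex (Q0 + Q0)%type) : module RNak :=
  Module (quot_mod_on (@simple_path_mesh u)).

Definition stable (M : module RNak) : Prop :=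
  forall (x : rvertex Q0) (h : mod_hom (simple_mod (nonfrozen x)) M),
    h = mod_zero _ _.

Definition costable (M : module RNak) : Prop :=
  forall (x : rvertex Q0) (h : mod_hom M (simple_mod (nonfrozen x))),
    h = mod_zero _ _.

End Nakajima.

(** Finitely supported dimension vectors, on the non frozen vertices [ZQ_0] or
    on [S_0], where the frozen vertex [(i', p)] is represented by [(i, p)]. *)
Notation dimvec Q0 := {fsfun rvertex Q0 -> nat of _ => 0%N}.

Section QuiverVarieties.
Variables (k : fieldType) (Q0 Q1 : finType) (Q : quiver Q0 Q1).
Implicit Types v w : dimvec Q0.

Definition SSpace w (u : rvertex Q0) : lmodType k := 'rV[k]_(w u).

Definition rdim v w (x : rvertex (Q0 + Q0)%type) : nat :=
  match base x with
  | inl i => v (RVertex i (level x))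
  | inr i => w (RVertex i (level x))
  end.

Definition RSpace v w (x : rvertex (Q0 + Q0)%type) : lmodType k :=
  'rV[k]_(rdim v w x).

Definition M0 w := @mod_on k (SNak k Q) (SSpace w).

Definition M0_mod w (M : M0 w) : module (SNak k Q) := Module M.

Record Mtilde v w := MTilde {
  mt_mod_on : @mod_on k (RNak k Q) (RSpace v w);
  mt_stable : stable (Module mt_mod_on) }.

Definition mt_mod v w (N : Mtilde v w) : module (RNak k Q) :=
  Module (mt_mod_on N).

HB.instance Definition _ v w := gen_eqMixin (Mtilde v w).
HB.instance Definition _ v w := gen_choiceMixin (Mtilde v w).

(** The group [G_v], extended by the identity at the frozen vertices. *)
Definition extend_gl v w (g : forall x : rvertex Q0, 'M[k]_(v x))
    (x : rvertex (Q0 + Q0)%type) : 'M[k]_(rdim v w x) :=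
  match base x as b return 'M[k]_(match b with
                                  | inl i => v (RVertex i (level x))
                                  | inr i => w (RVertex i (level x))
                                  end) with
  | inl i => g (RVertex i (level x))
  | inr i => 1%:M
  end.

(** [N'] is [g] applied to [N]; matrices act on row vectors from the right. *)
Definition base_change v w (g : forall x : rvertex Q0, 'M[k]_(v x))
    (N N' : Mtilde v w) : Prop :=
  forall (x y : RNak k Q) (f : hom x y) (m : RSpace v w y),
    act (mt_mod_on N') f (m *m extend_gl w g y : RSpace v w y)
    = act (mt_mod_on N) f m *m extend_gl w g x.

Definition orbit_rel v w (N N' : Mtilde v w) : bool :=
  `[< exists g : forall x : rvertex Q0, 'M[k]_(v x),
        (forall x, g x \in unitmx) /\ base_change g N N' >].

Lemma extend_gl1 v w x : extend_gl w (fun x => 1%:M : 'M[k]_(v x)) x = 1%:M.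
Proof. by case: x => [[i|i] p]. Qed.

Lemma extend_glM v w (g h : forall x : rvertex Q0, 'M[k]_(v x)) x :
  extend_gl w (fun x => g x *m h x) x = extend_gl w g x *m extend_gl w h x.
Proof. by case: x => [[i|i] p] //; rewrite mulmx1. Qed.

Lemma extend_gl_unit v w (g : forall x : rvertex Q0, 'M[k]_(v x)) x :
  (forall x, g x \in unitmx) -> extend_gl w g x \in unitmx.
Proof. by move=> h; case: x => [[i|i] p]; [apply: h|apply: unitmx1]. Qed.

Lemma extend_glV v w (g : forall x : rvertex Q0, 'M[k]_(v x)) x :
  extend_gl w (fun x => invmx (g x)) x = invmx (extend_gl w g x).
Proof. by case: x => [[i|i] p] //; rewrite invmx1. Qed.

Lemma orbit_equiv v w : equiv_class_of (@orbit_rel v w).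
Proof.
have sym N N' : @orbit_rel v w N N' -> orbit_rel N' N.
  move/asboolP=> [g [gu gN]]; apply/asboolP.
  exists (fun x => invmx (g x)); split=> [x|x y f m].
    by rewrite unitmx_inv.
  have u z := @extend_gl_unit v w g z gu.
  rewrite !extend_glV; apply: (can_inj (mulmxK (u x))).
  by rewrite mulmxKV // -gN mulmxKV.
split=> [N|N N'|N' N N''].
- apply/asboolP; exists (fun x => 1%:M); split=> [x|x y f m].
    exact: unitmx1.
  by rewrite !extend_gl1 !mulmx1.
- by apply/idP/idP; apply: sym.
- move=> /asboolP[g [gu gN]] /asboolP[h [hu hN]]; apply/asboolP.
  exists (fun x => g x *m h x); split=> [x|x y f m].
    by rewrite unitmx_mul gu hu.
  by rewrite !extend_glM !mulmxA hN gN.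
Qed.

Canonical orbit_equivRel v w := EquivRelPack (@orbit_equiv v w).
Canonical orbit_encModRel v w := defaultEncModRel (@orbit_rel v w).

Definition Mvar v w := {eq_quot (@orbit_rel v w)}.

Definition Mclass v w (N : Mtilde v w) : Mvar v w := \pi_(Mvar v w) N.

Definition res_M0 v w (N : Mtilde v w) : M0 w :=
  @res_on k (RNak k Q) (rvertex Q0) (@frozen Q0) _ (mt_mod_on N).

Definition pi_M0 v w (O : Mvar v w) : M0 w := res_M0 (repr O).

Lemma res_M0_orbit v w (N N' : Mtilde v w) :
  orbit_rel N N' -> res_M0 N = res_M0 N'.
Proof.
move=> /asboolP[g [_ gN]]; apply: mod_on_eq => x y f m.
by have := gN _ _ f m; rewrite /extend_gl /= !mulmx1 => ->.
Qed.

Lemma pi_M0E v w (N : Mtilde v w) : pi_M0 (Mclass N) = res_M0 N.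
Proof.
by apply: res_M0_orbit; apply/eqmodP; rewrite reprK.
Qed.

Definition Mreg v w : set (Mvar v w) :=
  [set O | exists2 N : Mtilde v w, costable (mt_mod N) & O = Mclass N].

Definition reg_image v w : set (M0 w) := [set pi_M0 O | O in @Mreg v w]%classic.

Definition is_stratum w (X : set (M0 w)) : Prop :=
  (X !=set0)%classic /\ exists v, X = @reg_image v w.

Section Kan.
Variables KL KR : functor (Mod (SNak k Q)) (Mod (RNak k Q)).
Variables (adjL : adjunction KL (resRS k Q)) (adjR : adjunction (resRS k Q) KR).
Variable M : module (SNak k Q).

(** The morphism [res (KL M) -> res (KR M)] is the identity of [M] under the
    unit [M -> res (KL M)] and the counit [res (KR M) -> M]. *)
Definition restricts_to_id (c : mor (KL M) (KR M)) : Prop :=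
  mcomp (adj_counit adjR M) (mcomp (fmor (resRS k Q) c) (adj_unit adjL M))
  = mid (M : Mod _).

(** As [KL] and [KR] are fully faithful, exactly one morphism restricts to the
    identity; the zero morphism only serves to make the definition total. *)
Definition canonical_mor : mor (KL M) (KR M) :=
  if pselect (exists c, restricts_to_id c) is left e then projT1 (cid e)
  else @mod_zero k (RNak k Q) (KL M) (KR M).

Definition KLR : module (RNak k Q) :=
  @image_mod k (RNak k Q) (KL M) (KR M) canonical_mor.

(** The canonical morphism [M -> res (KLR M)], by which the restriction of
    [KLR M] is identified with [M]. *)
Definition KLR_unit : mor (M : Mod _) (resRS k Q KLR) :=
  mcomp (fmor (resRS k Q)
      (image_proj canonical_mor : mor (KL M) (KLR : Mod (RNak k Q))))
    (adj_unit adjL M).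

End Kan.

(** The point [O] of [M(v, w)] is the one defined by the module [K], whose
    restriction to [S] is identified with [M] by [i]. *)
Definition point_of v w (M : M0 w) (K : module (RNak k Q))
    (i : mod_hom (M0_mod M) (resRS k Q K)) (O : Mvar v w) : Prop :=
  exists2 N : Mtilde v w, O = Mclass N &
  exists2 phi : mod_hom (mt_mod N) K, is_iso phi &
    forall (u : rvertex Q0) (m : 'rV[k]_(w u)), phi (frozen u) m = i u m.

End QuiverVarieties.

Arguments reg_image k {Q0 Q1} Q v w.
Arguments KLR {k Q0 Q1 Q KL KR} adjL adjR M.
Arguments KLR_unit {k Q0 Q1 Q KL KR} adjL adjR M.
Arguments point_of {k Q0 Q1 Q v w M K} i O.

(* Main.v *)
From HB Require Import structures.
Require Import Defs.
From mathcomp Require Import all_boot all_order all_algebra.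
From mathcomp Require Import finmap boolp classical_sets reals.
From mathcomp Require Import complex monalg zify.

Set Implicit Arguments.
Unset Strict Implicit.
Unset Printing Implicit Defensive.

Import Order.TTheory GRing.Theory Num.Theory.

Local Open Scope ring_scope.

Local Notation hom := Defs.hom.

(** The proof characterizes intermediate Kan extensions by two properties of an
    [R]-module [N]: it is generated when the elements [act N f m], with [m] at a
    frozen vertex, span it, and cogenerated when an element is zero as soon as
    every morphism from a frozen vertex annihilates it.

    Formally, for any full subcategory, [KL M] is generated (the submodule
    generated by the image of the unit splits off, by the universal property)
    and [KR M] is cogenerated (an element is a morphism from a representable
    module, hence by adjunction a family of elements of [M]).  By Yoneda the
    counit [res (KR M) -> M] is an isomorphism, so the canonical morphism exists
    and its image [K] restricts to [M].  As an image, [K] is both generated and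
    cogenerated ([KLR_generated], [KLR_cogenerated]).  A simple module [S_x],
    with [x] non frozen, vanishes at the frozen vertices, so a generated module
    has no nonzero morphism to it and a cogenerated module none from it: [K] is
    stable and co-stable.

    Acyclicity of [Q] gives a rank on the vertices of the repetition quiver that
    increases along every arrow, and at each level only finitely many ranks
    occur.  Induction along this rank has two uses.  First, [K] is
    finite-dimensional at every vertex, since cogeneration embeds [K x], for
    [x] non frozen, in the sum of the [K y] over the finitely many arrows
    [y -> x]; as [K] lives between the lowest and the highest level of the
    support of [w], it defines a point of some [M(v, w)] ([realization]).
    Secondly, for modules of bounded support the converse holds: stable implies
    cogenerated, since an element annihilated by all the arrows that end at [x]
    is a morphism from [S_x], and co-stable implies generated, dually, by a
    linear form that vanishes on the generated part.

    Finally an isomorphism between the restrictions of two modules that are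
    generated and cogenerated extends to an isomorphism of the modules
    ([extension_iso]).  Hence a regular point over [M] has the dimension vector
    and the [G_v]-orbit of [K], which is the uniqueness of the stratum and of
    the pre-image. *)

(** * Modules generated or cogenerated by a full subcategory *)

Section Submodule.
Variables (k : fieldType) (C : lincat k) (N : module C).
Variable P : forall x, submodClosed (N x).
Hypothesis actP : forall x y (f : hom x y) n, n \in P y -> act N f n \in P x.

Record sub_space (x : C) := SubSpace {
  sub_val : N x;
  sub_valP : sub_val \in P x }.
HB.instance Definition _ x := [isSub for @sub_val x].
HB.instance Definition _ x := [Choice of sub_space x by <:].
HB.instance Definition _ x := [SubChoice_isSubLmodule of sub_space x by <:].

Definition submodule : module C.
Proof.
exists (fun x => sub_space x).
exists (fun x y f n => SubSpace (actP f (sub_valP n))).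
- by move=> x y m a f g; apply: val_inj; rewrite /= act_linl.
- by move=> x y f a m n; apply: val_inj; rewrite /= act_linr.
- by move=> x m; apply: val_inj; rewrite /= act1.
- by move=> x y z f g m; apply: val_inj; rewrite /= actM.
Defined.

Definition submodule_incl : mod_hom submodule N.
Proof. by exists (fun x (n : submodule x) => sub_val n). Defined.

End Submodule.

Section FullSubcategoryModules.
Variables (k : fieldType) (C : lincat k) (I : Type) (e : I -> C).
Local Notation D := (full_subcat e).

(** The value of the submodule generated by the objects [e u]; scalars are
    absorbed by [m]. *)
Inductive span_from (N : module C) (x : C) : N x -> Prop :=
| span_from0 : span_from 0
| span_from_add u (f : hom x (e u)) (m : N (e u)) n :
    span_from n -> span_from (act N f m + n).

Definition generated (N : module C) : Prop :=
  forall x (n : N x), span_from n.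

Definition cogenerated (N : module C) : Prop :=
  forall x (n : N x), (forall u (f : hom (e u) x), act N f n = 0) -> n = 0.

Section Span.
Variables (N : module C).

Lemma span_fromD x (m n : N x) :
  span_from m -> span_from n -> span_from (m + n).
Proof.
by elim=> [|u f a b _ IH] hn; rewrite ?add0r // -addrA; apply/span_from_add/IH.
Qed.

Lemma span_fromZ x a (n : N x) : span_from n -> span_from (a *: n).
Proof.
elim=> [|u f m b _ IH]; first by rewrite scaler0; apply: span_from0.
have -> : a *: (act N f m + b) = act N f (a *: m) + a *: b.
  by rewrite scalerDr -[a *: m]addr0 act_linr act0r addr0.
exact: span_from_add.
Qed.

Lemma span_from_act x y (f : hom x y) (n : N y) :
  span_from n -> span_from (act N f n).
Proof.
elim=> [|u g m b _ IH]; first by rewrite act0r; apply: span_from0.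
rewrite -[act N g m]scale1r act_linr scale1r -actM.
exact: span_from_add.
Qed.

Lemma span_from_obj u (n : N (e u)) : span_from n.
Proof.
rewrite -[n]addr0 -[n](act1 N).
exact/span_from_add/span_from0.
Qed.

Definition span_pred (x : C) : {pred N x} := fun n => `[< span_from n >].
Arguments span_pred : clear implicits.

Lemma span_submod_closed x : submod_closed (span_pred x).
Proof.
split; first exact/asboolP/span_from0.
move=> a m n /asboolP hm /asboolP hn; apply/asboolP.
by apply: span_fromD => //; apply: span_fromZ.
Qed.

HB.instance Definition _ x := GRing.isSubmodClosed.Build k (N x)
  (span_pred x) (span_submod_closed x).

Lemma span_pred_act x y (f : hom x y) n :
  n \in span_pred y -> act N f n \in span_pred x.
Proof. by move=> /asboolP h; apply/asboolP; apply: span_from_act. Qed.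

Definition span_mod : module C :=
  @submodule k C N (fun x => span_pred x) span_pred_act.

End Span.

Lemma span_from_mfun (N P : module C) (h : mod_hom N P) x (n : N x) :
  span_from n -> span_from (h x n).
Proof.
elim=> [|u f m b _ IH]; first by rewrite linear0; apply: span_from0.
by rewrite raddfD /= mfun_nat; apply: span_from_add.
Qed.

Definition representable (x : C) : module C.
Proof.
exists (fun y => hom y x); exists (fun y z f g => lcomp f g).
- by move=> y z m; apply: lcomp_linl.
- by move=> y z f; apply: lcomp_linr.
- by move=> y m; apply: lcomp1l.
- by move=> y z t f g m; rewrite lcompA.
Defined.

Definition yoneda (N : module C) x (n : N x) : mod_hom (representable x) N.
Proof.
exists (fun y (f : hom y x) => act N f n).
- by move=> y; apply: act_linl.
- by move=> y z f m; apply: actM.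
Defined.

Definition yoneda_res (M : module D) u (m : M u) :
  mod_hom (res_mod e (representable (e u))) M.
Proof.
exists (fun v (f : hom (e v) (e u)) => act M (f : @hom k D v u) m).
- by move=> v; apply: (@act_linl k D M M v u m).
- by move=> v t f g; apply: (actM M).
Defined.

Variables KL KR : functor (Mod D) (Mod C).
Variables (adjL : adjunction KL (res e)) (adjR : adjunction (res e) KR).
Variable M : module D.

Local Notation eps := (adj_counit adjR M : mod_hom (res_mod e (KR M)) M).
Local Notation eta := (adj_unit adjL M : mod_hom M (res_mod e (KL M))).

Lemma adjV_counit (N : module C) (g : mod_hom N (KR M)) u (n : N (e u)) :
  (adjV adjR (g : mor (N : Mod C) (KR M)) : mod_hom (res_mod e N) M) u n
    = eps u (g (e u) n).
Proof.
suff -> : adjV adjR (g : mor (N : Mod C) (KR M)) =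
    mcomp (eps : mor (res e (KR M)) (M : Mod D)) (fmor (res e) g) by [].
apply: (can_inj (@adjK _ _ _ _ adjR _ _)).
by rewrite adjVK adj_natl adjVK mcomp1l.
Qed.

Lemma adj_unitE (N : module C) (g : mod_hom (KL M) N) u (m : M u) :
  (adj adjL (g : mor (KL M) (N : Mod C)) : mod_hom M (res_mod e N)) u m
    = g (e u) (eta u m).
Proof.
suff -> : adj adjL (g : mor (KL M) (N : Mod C)) =
    mcomp (fmor (res e) (g : mor (KL M : Mod C) (N : Mod C)))
      (eta : mor (M : Mod D) (res e (KL M))) by [].
by rewrite -adj_natr mcomp1r.
Qed.

(** An element [n] of [KR M x] is a morphism from the representable module of
    [x]; its adjoint is the family of the elements [eps u (act _ f n)], so that
    [n] is zero when they are. *)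
Lemma counit_cogenerated x (n : KR M x) :
  (forall u (f : hom (e u) x), eps u (act (KR M) f n) = 0) -> n = 0.
Proof.
move=> h.
suff e0 : yoneda n = mod_zero _ _.
  have := congr1 (fun g : mod_hom (representable x) (KR M) => g x (lid x)) e0.
  by rewrite /= act1.
apply: (can_inj (@adjVK _ _ _ _ adjR _ _)).
apply: mod_hom_eq => u f; rewrite [LHS]adjV_counit [RHS]adjV_counit /= h.
by rewrite linear0.
Qed.

Lemma counit_inj u (n : KR M (e u)) : eps u n = 0 -> n = 0.
Proof.
move=> h; apply: counit_cogenerated => v f.
by rewrite (mfun_nat eps (f : @hom k D v u)) h act0r.
Qed.

(** The restriction of the representable module of [e u] is representable as
    well, because the subcategory is full: [m] is a morphism from it to [M],
    and the adjoint of this morphism is the required element. *)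
Lemma counit_surj u (m : M u) : exists n : KR M (e u), eps u n = m.
Proof.
pose g := adj adjR
  (yoneda_res m : mor (res e (representable (e u) : Mod C)) (M : Mod D)).
exists ((g : mod_hom _ _) (e u) (lid (e u))).
rewrite -(adjV_counit (g : mod_hom _ _)) adjK /=.
exact: (act1 M).
Qed.

(** The unit factors through the submodule [G] generated by the objects [e u],
    which contains all the values at these objects.  The adjoint [r] of this
    factorization is a section of the inclusion of [G], by uniqueness of
    adjoints, so that [G] is everything. *)
Lemma KL_generated : generated (KL M).
Proof.
pose G := span_mod (KL M).
pose incl : mod_hom G (KL M) := submodule_incl _.
have etaP u m : eta u m \in span_pred (N := KL M) (x := e u).
  exact/asboolP/span_from_obj.
pose gfun u (m : M u) : G (e u) := SubSpace (x := e u) (etaP u m).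
have lin u : linear (gfun u).
  by move=> a m n; apply: val_inj; apply: (mfun_linear eta).
have nat u v (f : @hom k D u v) (m : M v) :
    gfun u (act M f m) = act G f (gfun v m).
  by apply: val_inj; apply: (mfun_nat eta).
pose eta' : mod_hom M (res_mod e G) := @ModHom _ _ M (res_mod e G) _ lin nat.
pose r := adjV adjL (eta' : mor (M : Mod D) (res e (G : Mod C))).
have er : mod_comp incl r = mod_id (KL M).
  apply: (can_inj (@adjK _ _ _ _ adjL _ _)).
  apply: mod_hom_eq => u m; rewrite [LHS]adj_unitE [RHS]adj_unitE /=.
  by rewrite -(adj_unitE (r : mod_hom _ _)) adjVK.
move=> x n.
have := congr1 (fun g : mod_hom _ _ => g x n) er => /= <-.
have h := sub_valP ((r : mod_hom (KL M) G) x n).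
by apply/asboolP; exact: h.
Qed.

Definition counit_inv_fun u (m : M u) : KR M (e u) :=
  projT1 (cid (counit_surj m)).

Lemma counit_invK u (m : M u) : eps u (counit_inv_fun m) = m.
Proof. exact: (projT2 (cid (counit_surj m))). Qed.

Lemma counit_injective u : injective (eps u).
Proof.
by move=> m n h; apply/subr0_eq/counit_inj; rewrite linearB /= h subrr.
Qed.

Definition counit_inv : mod_hom M (res_mod e (KR M)).
Proof.
exists counit_inv_fun => [u a m n|u v f m]; apply: counit_injective.
  by rewrite (mfun_linear eps u a (counit_inv_fun m)) !counit_invK.
by rewrite mfun_nat !counit_invK.
Defined.

(** The canonical morphism is the adjoint of the inverse of the counit. *)
Lemma canonical_exists :
  exists c : mor (KL M) (KR M),
    mcomp (adj_counit adjR M) (mcomp (fmor (res e) c) (adj_unit adjL M))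
  = mid (M : Mod _).
Proof.
exists (adjV adjL (counit_inv : mor (M : Mod D) (res e (KR M)))).
apply: mod_hom_eq => u m /=.
by rewrite -(adj_unitE (adjV adjL _ : mod_hom _ _)) adjVK /= counit_invK.
Qed.

End FullSubcategoryModules.

(** * The intermediate Kan extension *)

Section IntermediateExtension.
Variables (k : fieldType) (Q0 Q1 : finType) (Q : quiver Q0 Q1).
Local Notation frozenR := (@frozen Q0 : rvertex Q0 -> RNak k Q).
Variables KL KR : functor (Mod (SNak k Q)) (Mod (RNak k Q)).
Variables (adjL : adjunction KL (resRS k Q)) (adjR : adjunction (resRS k Q) KR).
Variable M : module (SNak k Q).

Local Notation eps := (adj_counit adjR M : mod_hom (res_mod frozenR (KR M)) M).
Local Notation eta := (adj_unit adjL M : mod_hom M (res_mod frozenR (KL M))).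
Local Notation c := (canonical_mor adjL adjR M : mod_hom (KL M) (KR M)).

Lemma canonical_morP u (m : M u) : eps u (c (frozen u) (eta u m)) = m.
Proof.
have : restricts_to_id adjL adjR (canonical_mor adjL adjR M).
  rewrite /canonical_mor; case: pselect => [h|[]].
    exact: (projT2 (cid h)).
  exact: (canonical_exists adjL adjR M).
by move=> /(congr1 (fun g : mod_hom M M => g u m)).
Qed.

Lemma KLR_cogenerated : cogenerated frozenR (KLR adjL adjR M).
Proof.
move=> x n h; apply: val_inj => /=.
apply: (counit_cogenerated (adjR := adjR)) => u f.
have := congr1 val (h u f) => /= ->.
by rewrite linear0.
Qed.

Lemma KLR_generated : generated frozenR (KLR adjL adjR M).
Proof.
move=> x [_ /[dup]/asboolP[n <-]] h.
have -> : LImg h = image_proj c x n by apply: val_inj.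
exact/span_from_mfun/KL_generated.
Qed.

Lemma KLR_unit_bij u : bijective ((KLR_unit adjL adjR M : mod_hom _ _) u).
Proof.
exists (fun n : KLR adjL adjR M (frozen u) => eps u (val n)) => [m|n].
  exact: canonical_morP.
apply: val_inj; apply: (counit_injective (adjR := adjR)).
exact: canonical_morP.
Qed.

End IntermediateExtension.

Section Simples.
Variables (k : fieldType) (Q0 Q1 : finType) (Q : quiver Q0 Q1).
Local Notation frozenR := (@frozen Q0 : rvertex Q0 -> RNak k Q).
Implicit Type N : module (RNak k Q).

Lemma simple_mod_frozen x u (m : simple_mod k Q (nonfrozen x) (frozen u)) :
  m = 0.
Proof. exact: thinmx0. Qed.

Lemma generated_costable N : generated frozenR N -> costable N.
Proof.
move=> gN x h; apply: mod_hom_eq => y n /=.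
elim: (gN y n) => [|u f m n' _ IH]; first by rewrite linear0.
by rewrite raddfD /= mfun_nat [h _ m]simple_mod_frozen act0r add0r.
Qed.

Lemma cogenerated_stable N : cogenerated frozenR N -> stable N.
Proof.
move=> gN x h; apply: mod_hom_eq => y m /=; apply: gN => u f.
by rewrite -mfun_nat [act _ f m]simple_mod_frozen linear0.
Qed.

End Simples.

(** * A rank function on the repetition quiver *)

Section Depth.
Variables (V A : finType) (Q : quiver V A).

Definition arrow_rel : rel V := fun x y =>
  [exists a, (src Q a == x) && (tgt Q a == y)].

(** The number of vertices from which there is a path to [x].  In an acyclic
    quiver it increases along every arrow, because the target itself is a new
    such vertex. *)
Definition depth (x : V) : nat := #|[pred y | connect arrow_rel y x]|.

Lemma connect_is_path x y : connect arrow_rel x y -> exists s, is_path Q x s y.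
Proof.
case/connectP=> p; elim: p x => [|z p IH] x /=.
  by move=> _ ->; exists [::] => /=.
case/andP=> /existsP[a /andP[/eqP <- /eqP <-]] /IH h /h [s hs].
by exists (a :: s) => /=; rewrite eqxx.
Qed.

Lemma depth_lt (Qacyclic : acyclic Q) a : (depth (src Q a) < depth (tgt Q a))%N.
Proof.
have arr : arrow_rel (src Q a) (tgt Q a).
  by apply/existsP; exists a; rewrite !eqxx.
apply: fintype.proper_card; apply/fintype.properP; split.
  apply/fintype.subsetP=> y; rewrite !inE => h; apply: connect_trans h _.
  exact: connect1.
exists (tgt Q a); rewrite !inE ?connect0 //.
apply/negP => /connect_is_path[s hs].
by have := @Qacyclic (src Q a) (a :: s); rewrite /= eqxx hs => /(_ isT).
Qed.

Lemma depth_le x : (depth x <= #|V|)%N.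
Proof. exact: max_card. Qed.

End Depth.

Section Rank.
Variables (V A : finType) (Q : quiver V A).


(** Every [i'] is put above all the vertices of [Q]. *)
Definition framed_depth (x : V + V) : nat :=
  match x with inl i => depth Q i | inr i => #|V|.+1 end.

(** Along an arrow [(a, p)] the level is constant and the depth increases; along
    [sigma(a, p)] the level increases, and the factor exceeds every depth. *)
Definition rank (x : rvertex (V + V)%type) : int :=
  (#|V|.+2)%:Z * level x + (framed_depth (base x))%:Z.

Lemma rank_lt (Qacyclic : acyclic Q) b :
  (rank (src (ZQt Q) b) < rank (tgt (ZQt Q) b))%R.
Proof.
have dle i : (framed_depth i < #|V|.+2)%N.
  by case: i => i //=; rewrite ltnS ltnW // ltnS depth_le.
have rankE i p :
  rank (RVertex i p) = (#|V|.+2)%:Z * p + (framed_depth i)%:Z by [].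
case: b => [[a p]|[a p]].
  rewrite [X in (X < _)%R]rankE [X in (_ < X)%R]rankE ltrD2l ltz_nat.
  by case: a => [a|i]; [apply: depth_lt|rewrite ltnS depth_le].
rewrite [X in (X < _)%R]rankE [X in (_ < X)%R]rankE.
by have := dle (tgt (framed Q) a); lia.
Qed.

(** A vertex of rank less than [(#|V| + 2) * l] has level less than [l], so that
    ordinary induction on the excess of the rank over this value applies. *)
Lemma ascending_ind (Qacyclic : acyclic Q) (l : int)
    (P : rvertex (V + V)%type -> Prop) :
  (forall x, (level x < l)%R -> P x) ->
  (forall x, (forall b, tgt (ZQt Q) b = x -> P (src (ZQt Q) b)) -> P x) ->
  forall x, P x.
Proof.
move=> P0 PS.
suff h (n : nat) x : (rank x < (#|V|.+2)%:Z * l + n%:Z)%R -> P x.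
  by move=> x; apply: (h (absz (rank x - (#|V|.+2)%:Z * l)%R).+1 x); lia.
elim: n x => [|n IH] x hx.
  by apply: P0; move: hx; rewrite /rank; nia.
by apply: PS => b eb; apply: IH; have := rank_lt Qacyclic b; rewrite eb; lia.
Qed.

Lemma descending_ind (Qacyclic : acyclic Q) (l : int)
    (P : rvertex (V + V)%type -> Prop) :
  (forall x, (l < level x)%R -> P x) ->
  (forall x, (forall b, src (ZQt Q) b = x -> P (tgt (ZQt Q) b)) -> P x) ->
  forall x, P x.
Proof.
move=> P0 PS.
have dle i : (framed_depth i < #|V|.+2)%N.
  by case: i => i //=; rewrite ltnS ltnW // ltnS depth_le.
suff h (n : nat) x : ((#|V|.+2)%:Z * (l + 1) - n%:Z <= rank x)%R -> P x.
  move=> x; apply: (h (absz (rank x - (#|V|.+2)%:Z * (l + 1))%R) x); lia.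
elim: n x => [|n IH] x hx.
  by apply: P0; move: hx; rewrite /rank; have := dle (base x); nia.
by apply: PS => b eb; apply: IH; have := rank_lt Qacyclic b; rewrite eb; lia.
Qed.

End Rank.

(** * Subspaces and finite dimension *)

Section Subspace.
Variables (k : fieldType) (d : nat) (P : 'rV[k]_d -> Prop).
Hypotheses (P0 : P 0) (PD : forall a u v, P u -> P v -> P (a *: u + v)).

(** A matrix of maximal rank among those whose row space lies in [P] works:
    adding a further vector of [P] would increase its rank. *)
Lemma subspace_matrix : exists A : 'M[k]_d, forall v, P v <-> (v <= A)%MS.
Proof.
pose inP (A : 'M[k]_d) := forall u : 'rV_d, (u <= A)%MS -> P u.
have ex0 : exists r, `[< exists2 A, inP A & \rank A = r >].
  exists 0%N; apply/asboolP; exists 0; last exact: mxrank0.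
  by move=> u; rewrite submx0 => /eqP ->.
have bnd r : `[< exists2 A, inP A & \rank A = r >] -> (r <= d)%N.
  by move=> /asboolP[A _ <-]; exact: rank_leq_row.
case: (ex_maxnP ex0 bnd) => _ /asboolP[A PA <-] maxA.
exists A => v; split=> [Pv|/PA //].
have PAv : inP (A + v)%MS.
  move=> u /sub_addsmxP[[a b] /= ->].
  rewrite [b]mx11_scalar mul_scalar_mx addrC; apply: PD => //.
  by apply: PA; apply: submxMl.
have le : (\rank (A + v)%MS <= \rank A)%N.
  by apply: maxA; apply/asboolP; exists (A + v)%MS.
apply: submx_trans (addsmxSr A v) _.
by rewrite -(geq_leqif (mxrank_leqif_sup (addsmxSl A v))).
Qed.

Lemma subspace_separation v : ~ P v ->
  exists phi : {linear 'rV[k]_d -> k^o},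
    (forall u, P u -> phi u = 0) /\ phi v <> 0.
Proof.
have [A hA] := subspace_matrix; move=> /hA/negP; rewrite submxE => /rV0Pn[j hj].
have lin : linear (fun u : 'rV[k]_d => (u *m cokermx A) 0 j : k^o).
  by move=> a u u'; rewrite mulmxDl -scalemxAl !mxE.
pose phi : {linear 'rV[k]_d -> k^o} :=
  HB.pack (fun u : 'rV[k]_d => (u *m cokermx A) 0 j : k^o)
    (GRing.isLinear.Build _ _ _ _ _ lin).
exists phi.
split=> [u /hA|]; last exact/eqP.
by rewrite submxE /= => /eqP ->; rewrite mxE.
Qed.

End Subspace.

Lemma inj_surj_bijective (T T' : Type) (f : T -> T') :
  injective f -> (forall y, exists x, f x = y) -> bijective f.
Proof.
move=> fi fs; exists (fun y => projT1 (cid (fs y))) => [x|y].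
  exact/fi/(projT2 (cid (fs (f x)))).
exact: (projT2 (cid (fs y))).
Qed.

Section FiniteDimension.
Variable k : fieldType.
Implicit Types V W : lmodType k.

(** Finite dimension, in a form that passes to spaces embedded in a finite
    product without a choice of coordinates: finitely many linear forms
    separate the points. *)
Definition findim V : Prop :=
  exists (T : finType) (phi : T -> {linear V -> k^o}),
    forall v, (forall t, phi t v = 0) -> v = 0.

Lemma findim_joint V (T : finType) (W : T -> lmodType k)
    (f : forall t, {linear V -> W t}) :
  (forall t, findim (W t)) -> (forall v, (forall t, f t v = 0) -> v = 0) ->
  findim V.
Proof.
move=> fW f0.
pose S t := projT1 (cid (fW t)).
pose phi t : S t -> {linear W t -> k^o} := projT1 (cid (projT2 (cid (fW t)))).
have phi0 t : forall v, (forall s, phi t s v = 0) -> v = 0 :=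
  projT2 (cid (projT2 (cid (fW t)))).
exists {t : T & S t},
  (fun s => phi (tag s) (tagged s) \o f (tag s) : {linear V -> k^o}).
move=> v hv; apply: f0 => t; apply: phi0 => s.
exact: (hv (Tagged S s)).
Qed.

Lemma findim_rV d : findim 'rV[k]_d.
Proof.
have lin j : linear (fun v : 'rV[k]_d => v 0 j : k^o).
  by move=> a u v; rewrite !mxE.
exists 'I_d, (fun j => HB.pack_for {linear 'rV[k]_d -> k^o}
  (fun v : 'rV[k]_d => v 0 j : k^o) (GRing.isLinear.Build _ _ _ _ _ (lin j))).
by move=> v hv; apply/rowP => j; rewrite mxE; apply: hv.
Qed.

Lemma findim_inj V (W : lmodType k) (f : {linear V -> W}) :
  findim W -> (forall v, f v = 0 -> v = 0) -> findim V.
Proof.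
move=> fW f0.
by apply: (@findim_joint V unit (fun=> W) (fun=> f)) => // v /(_ tt)/f0.
Qed.

Lemma findim_trivial V : (forall v : V, v = 0) -> findim V.
Proof.
by move=> V0; exists void, (fun t : void => match t with end) => v _; apply: V0.
Qed.

Lemma findim_basis V : findim V ->
  exists d, exists f : {linear 'rV[k]_d -> V}, bijective f.
Proof.
case=> T [phi phi0].
pose j (v : V) : 'rV[k]_#|T| := \row_i phi (enum_val i) v.
have jlin a u v : j (a *: u + v) = a *: j u + j v.
  by apply/rowP => i; rewrite !mxE linearP.
have jinj u v : j u = j v -> u = v.
  move=> /rowP e; apply/subr0_eq/phi0 => t.
  have := e (enum_rank t); rewrite !mxE enum_rankK linearB /= => ->.
  by rewrite subrr.
have [||A hA] := @subspace_matrix k _ (fun v => exists u, j u = v).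
- by exists 0; apply/rowP => i; rewrite !mxE linear0.
- by move=> a _ _ [u <-] [v <-]; exists (a *: u + v).
have ex (r : 'rV[k]_(\rank A)) : exists v, j v = r *m row_base A.
  by apply/hA; rewrite -(eq_row_base A) submxMl.
pose f r := projT1 (cid (ex r)).
have jf r : j (f r) = r *m row_base A by exact: (projT2 (cid (ex r))).
have flin : linear f.
  by move=> a u v; apply: jinj; rewrite jlin !jf mulmxDl scalemxAl.
exists (\rank A), (HB.pack_for {linear 'rV[k]_(\rank A) -> V} f
  (GRing.isLinear.Build _ _ _ _ _ flin)).
apply: inj_surj_bijective => [u v /= /(congr1 j)|v].
  by rewrite !jf; apply: row_free_inj; apply: row_base_free.
have /submxP[r er] : (j v <= row_base A)%MS.
  by rewrite eq_row_base; apply/hA; exists v.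
by exists r; apply: jinj; rewrite /= jf er.
Qed.

Lemma rV_bijective_dim a b (f : {linear 'rV[k]_a -> 'rV[k]_b}) :
  bijective f -> a = b.
Proof.
have le c d (h : {linear 'rV[k]_c -> 'rV[k]_d}) : injective h -> (c <= d)%N.
  move=> hi; have : row_free (lin1_mx h).
    apply/inj_row_free => v; rewrite mul_rV_lin1 => hv.
    by apply: hi; rewrite hv linear0.
  by move=> /eqP <-; apply: rank_leq_col.
move=> bf; case: (bf) => g fK gK.
have glin : linear g.
  by move=> c u v; apply: (bij_inj bf); rewrite linearP /= !gK.
apply/eqP; rewrite eqn_leq (le _ _ f (bij_inj bf)) /=.
apply: (le _ _ (HB.pack_for {linear 'rV[k]_b -> 'rV[k]_a} g
  (GRing.isLinear.Build _ _ _ _ _ glin))) => /=.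
exact: (can_inj gK).
Qed.

Lemma findim_codomain d V (f : {linear 'rV[k]_d -> V}) :
  bijective f -> findim V.
Proof.
move=> bf; case: (bf) => g fK gK.
have glin : linear g.
  by move=> c u v; apply: (bij_inj bf); rewrite linearP /= !gK.
pose h : {linear V -> 'rV[k]_d} :=
  HB.pack g (GRing.isLinear.Build _ _ _ _ _ glin).
apply: (findim_inj (f := h) (findim_rV d)) => v /= gv0.
by rewrite -[v]gK gv0 linear0.
Qed.

End FiniteDimension.

(** * Paths and morphisms of the Nakajima category *)

Section PathDecomposition.
Variables (V A : choiceType) (Q : quiver V A).

(** The arrow is kept as a path between the given vertices, to avoid a transport
    along the equality of [x] with the source of [b]. *)
Lemma path_first x y (p : qpath Q x y) : arrows p != [::] ->
  exists b (h : is_path Q x [:: b] (tgt Q b))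
    (q : qpath Q (tgt Q b) y), p = path_cat (QPath h) q.
Proof.
case: p => -[|b s] //= /[dup] /andP[hb hs] hp _.
have h : is_path Q x [:: b] (tgt Q b) by rewrite /= hb eqxx.
by exists b, h, (QPath hs); apply: val_inj.
Qed.

Lemma path_last x y (p : qpath Q x y) : arrows p != [::] ->
  exists b (q : qpath Q x (src Q b))
    (h : is_path Q (src Q b) [:: b] y), p = path_cat q (QPath h).
Proof.
case: p => s hp /=; case/lastP: s hp => // s b hp _.
have [hs h] : is_path Q x s (src Q b) /\ is_path Q (src Q b) [:: b] y.
  rewrite /= eqxx; elim: s x hp => [|c s IH] x /=.
    by case/andP=> /eqP -> ->; rewrite eqxx.
  by case/andP=> -> /IH /= [-> ->].
by exists b, (QPath hs), h; apply: val_inj; rewrite /= cats1.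
Qed.

End PathDecomposition.

Section Paths.
Variables (k : fieldType) (Q0 Q1 : finType) (Q : quiver Q0 Q1).
Local Notation R := (RNak k Q).
Local Notation frozenR := (@frozen Q0 : rvertex Q0 -> R).

Definition path_hom (x y : R) (p : qpath (ZQt Q) x y) : hom x y :=
  qpi (@mesh_relation k Q0 Q1 Q) (<< p >> : @hom k (path_lincat k (ZQt Q)) x y).

Arguments path_hom {x y} p.

Lemma hom_path_ind (x y : R) (P : hom x y -> Prop) :
  P 0 -> (forall a f g, P f -> P g -> P (a *: f + g)) ->
  (forall p, P (path_hom p)) -> forall f, P f.
Proof.
move=> P0 PD Pp; apply: qpiW => f.
pose P' (g : phom k (ZQt Q) x y) :=
  P (qpi (@mesh_relation k Q0 Q1 Q) (x := x) (y := y) g).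
suff : P' f by [].
rewrite [f]monalgE; apply: (big_rec P') => [|p g _ hg]; rewrite /P'.
  have := qpi_linear (@mesh_relation k Q0 Q1 Q) (x := x) (y := y) (-1) 0 0.
  by rewrite scaler0 addr0 scaleN1r addNr => ->.
have -> : << f@_p *g p >> = f@_p *: (<< p >> : phom k (ZQt Q) x y).
  by apply/malgP => q; rewrite mcoeffZ !mcoeffU mulrnAr mulr1.
have -> := qpi_linear (@mesh_relation k Q0 Q1 Q) (x := x) (y := y)
  f@_p << p >> g.
exact: (PD _ (path_hom p) _ (Pp p) hg).
Qed.

Lemma path_hom_nil x : path_hom (path_nil (ZQt Q) x) = lid (x : R).
Proof. by []. Qed.

Lemma path_hom_cat x y z (p : qpath (ZQt Q) x y) (q : qpath (ZQt Q) y z) :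
  path_hom (path_cat p q) = lcomp (path_hom p) (path_hom q).
Proof. by rewrite [RHS]qcomp_pi [lcomp _ _]pcompU. Qed.

Lemma is_path_level x s y : is_path (ZQt Q) x s y -> (level x <= level y)%R.
Proof.
elim: s x => [|b s IH] x /=; first by move/eqP->.
case/andP=> /eqP <- /IH; apply: le_trans.
by case: b => -[a p] //; change (p - 1 <= p)%R; lia.
Qed.

Lemma hom_level (x y : R) (f : hom x y) : (level y < level x)%R -> f = 0.
Proof.
move=> lt; elim/hom_path_ind: f => [//|a f g -> ->|p].
  by rewrite scaler0 addr0.
by have := is_path_level (qpathP p); rewrite leNgt lt.
Qed.

Lemma simple_act_path u x y (p : qpath (ZQt Q) x y) (m : simple_mod k Q u y) :
  arrows p != [::] -> act (simple_mod k Q u) (path_hom p) m = 0.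
Proof.
move=> hp.
rewrite [LHS](act_qrepr (@simple_path_mesh k Q0 Q1 Q u)
  (<< p >> : @hom k (path_lincat k (ZQt Q)) x y)) /=.
by rewrite /aug pextU; case: (arrows p) hp => //= *; rewrite scale0r.
Qed.

End Paths.

Arguments path_hom k {Q0 Q1 Q x y} p.

(** * Stability and co-stability *)

Section Transport.
Variables (k : fieldType) (T : Type) (V : T -> lmodType k).

(** The identity when the two indices agree and zero otherwise; it defines
    morphisms from and to a module concentrated at one vertex. *)
Definition transport (z x : T) (n : V x) : V z :=
  if pselect (z = x) is left e then eq_rect_r (fun t => V t : Type) n e else 0.

Lemma transport_id x (n : V x) : transport x n = n.
Proof.
rewrite /transport; case: pselect => // e.
by rewrite (Prop_irrelevance e (erefl x)).
Qed.

Lemma transport_linear z x : linear (@transport z x).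
Proof.
move=> a m n; rewrite /transport; case: pselect => [e|_].
  by subst z.
by rewrite scaler0 addr0.
Qed.

End Transport.

Section Nonfrozen.
Variables (k : fieldType) (Q0 Q1 : finType) (Q : quiver Q0 Q1).
Hypothesis Qacyclic : acyclic Q.
Local Notation R := (RNak k Q).
Local Notation frozenR := (@frozen Q0 : rvertex Q0 -> R).

Lemma simple_off (u z : rvertex (Q0 + Q0)%type) (m : simple_mod k Q u z) :
  z <> u -> m = 0.
Proof.
move=> /eqP /negPf zu; apply/rowP => -[j hj]; exfalso.
by move: hj; rewrite zu.
Qed.

Section HomFromSimple.
Variables (N : module R) (x : rvertex Q0) (n : N (nonfrozen x)).
Hypothesis killed : forall z (p : qpath (ZQt Q) z (nonfrozen x)),
  arrows p != [::] -> act N (path_hom k p) n = 0.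

(** The morphism [S_x -> N] defined by [n].  The value of [S_x] at [z] is a
    space of row vectors of length one or zero; the sum is the single
    coordinate, or zero. *)
Definition from_simple_fun z (m : simple_mod k Q (nonfrozen x) z) : N z :=
  (\sum_j (m : 'rV[k]_(z == nonfrozen x)) 0 j) *: transport z n.

Lemma from_simple_linear z : linear (@from_simple_fun z).
Proof.
move=> a m m'; rewrite /from_simple_fun scalerA -scalerDl; congr (_ *: _).
by rewrite mulr_sumr -big_split; apply: eq_bigr => j _; rewrite !mxE.
Qed.

Lemma from_simple_nat y z (f : hom y z) m :
  from_simple_fun (act (simple_mod k Q (nonfrozen x)) f m)
  = act N f (from_simple_fun m).
Proof.
have [zx|zx] := pselect (z = nonfrozen x); last first.
  rewrite (simple_off m zx) act0r.
  have fs0 t : @from_simple_fun t 0 = 0.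
    by have := from_simple_linear (-1) (0 : simple_mod k Q _ t) 0;
      rewrite scaler0 addr0 scaleN1r addNr.
  by rewrite !fs0 act0r.
subst z.
elim/hom_path_ind: f => [|a f g hf hg|p].
- by rewrite !act0l /from_simple_fun big1 ?scale0r // => j _; rewrite mxE.
- by rewrite (act_linl _ m) (act_linl N _) from_simple_linear hf hg.
have [p0|p0] := eqVneq (arrows p) [::]; last first.
  rewrite simple_act_path // /from_simple_fun transport_id.
  have := act_linr N (path_hom k p)
    (\sum_j (m : 'rV[k]_(_ == nonfrozen x)) 0 j) n 0.
  rewrite act0r !addr0 => ->; rewrite killed // scaler0.
  by rewrite big1 ?scale0r // => j _; rewrite mxE.
have e : y = nonfrozen x by have := qpathP p; rewrite p0 => /eqP.
subst y.
have -> : p = path_nil (ZQt Q) _ by apply: val_inj.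
by rewrite path_hom_nil !act1.
Qed.

Definition from_simple : mod_hom (simple_mod k Q (nonfrozen x)) N :=
  ModHom from_simple_linear from_simple_nat.

Lemma stable_killed : stable N -> n = 0.
Proof.
move=> /(_ x from_simple).
move=> /(congr1 (fun g : mod_hom (simple_mod k Q (nonfrozen x)) N =>
  g (nonfrozen x) (const_mx 1))).
rewrite /= /from_simple_fun transport_id.
rewrite (eq_bigr (fun=> 1)) => [|j _]; last by rewrite mxE.
by rewrite sumr_const card_ord eqxx scale1r.
Qed.

End HomFromSimple.

(** By induction, an element [n] over [x] that is annihilated by the morphisms
    from frozen vertices is annihilated by the arrows [y -> x], since its image
    over [y] has the same property.  So [n] is a morphism from [S_x]. *)
Lemma stable_cogenerated (N : module R) (l : int) :
  (forall x, (level x < l)%R -> forall n : N x, n = 0) ->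
  stable N -> cogenerated frozenR N.
Proof.
move=> N0 sN x.
elim/(ascending_ind Qacyclic (l := l)): x => [x /N0 h n _ //|x IH n hn].
case: x n IH hn => [[i|i] p] n IH hn; last first.
  by rewrite -[n](act1 N); apply: (hn (RVertex i p)).
apply: (stable_killed (x := RVertex i p)) => // z q /path_last[b [q' [h ->]]].
rewrite path_hom_cat actM.
rewrite [X in act N _ X](_ : _ = 0) ?act0r //.
apply: IH => [|u f]; last by rewrite -actM hn.
by have := h => /= /andP[_ /eqP].
Qed.

Section HomToSimple.
Variables (d : R -> nat) (A : @mod_on k R (fun x => 'rV[k]_(d x) : lmodType k)).
Local Notation N := (Module A).
Variables (x : rvertex Q0).
Variable phi : {linear 'rV[k]_(d (nonfrozen x)) -> k^o}.
Hypothesis killed : forall z (p : qpath (ZQt Q) (nonfrozen x) z) (m : N z),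
  arrows p != [::] -> phi (act N (path_hom k p) m) = 0.

(** Dually, a linear form [phi] that vanishes on the image of all the arrows out
    of [x] defines a morphism [N -> S_x]. *)
Definition to_simple_fun z (m : N z) : simple_mod k Q (nonfrozen x) z :=
  (phi (transport (V := N) (nonfrozen x) m) : k)
    *: (const_mx 1 : 'rV[k]_(z == nonfrozen x)).

Lemma to_simple_linear z : linear (@to_simple_fun z).
Proof.
move=> a m m'; rewrite /to_simple_fun.
by rewrite transport_linear linearP scalerDl scalerA.
Qed.

Lemma to_simple_nat y z (f : hom y z) m :
  to_simple_fun (act N f m)
  = act (simple_mod k Q (nonfrozen x)) f (to_simple_fun m).
Proof.
have [yx|yx] := pselect (y = nonfrozen x); last first.
  by rewrite [LHS]simple_off // [RHS]simple_off.
subst y.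
elim/hom_path_ind: f => [|a f g hf hg|p].
- by rewrite !act0l /to_simple_fun transport_id linear0 scale0r.
- rewrite (act_linl _ m) (act_linl (simple_mod k Q _) _).
  by rewrite to_simple_linear hf hg.
have [p0|p0] := eqVneq (arrows p) [::]; last first.
  by rewrite simple_act_path // /to_simple_fun transport_id killed // scale0r.
have e : nonfrozen x = z by have := qpathP p; rewrite p0 => /eqP.
subst z.
have -> : p = path_nil (ZQt Q) _ by apply: val_inj.
by rewrite path_hom_nil !act1.
Qed.

Definition to_simple : mod_hom N (simple_mod k Q (nonfrozen x)) :=
  ModHom to_simple_linear to_simple_nat.

Lemma costable_killed : costable N -> forall n, phi n = 0.
Proof.
move=> /(_ x to_simple) h n.
have := congr1 (fun g : mod_hom N (simple_mod k Q (nonfrozen x)) =>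
  g (nonfrozen x) n) h.
rewrite /= /to_simple_fun transport_id.
(* The value of [S_x] at [x] is a line. *)
have o : 'I_(nonfrozen x == nonfrozen x) by rewrite eqxx; exact: ord0.
by move=> /rowP/(_ o); rewrite !mxE mulr1.
Qed.

End HomToSimple.

(** By descending induction the image of every arrow out of [x] lies in the
    generated part [G] of [N x].  If an element were outside [G], a linear form
    zero on [G] and nonzero at this element would be a nonzero morphism to
    [S_x]. *)
Lemma costable_generated (d : R -> nat)
    (A : @mod_on k R (fun x => 'rV[k]_(d x) : lmodType k)) (l : int) :
  (forall x, (l < level x)%R -> d x = 0%N) ->
  costable (Module A) -> generated frozenR (Module A).
Proof.
move=> N0 cN x.
elim/(descending_ind Qacyclic (l := l)): x => [x /N0 dx n|x IH n].
  have -> : n = 0 by apply/rowP => -[j hj]; exfalso; move: hj; rewrite dx.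
  exact: span_from0.
case: x n IH => [[i|i] p] n IH; last first.
  by apply: (span_from_obj (e := frozenR) (u := RVertex i p)).
set x := RVertex (inl i) p in n IH *.
case: (pselect (span_from frozenR n)) => // nn.
have [|phi [phi0 []]] :=
  subspace_separation (span_from0 frozenR (Module A) x) _ nn.
  by move=> a u v hu hv; apply: span_fromD => //; apply: span_fromZ.
apply: (costable_killed (x := RVertex i p)) => // z q m.
move=> /path_first[b [h [q' ->]]].
rewrite path_hom_cat actM; apply: phi0; apply: span_from_act; apply: IH.
by have := h => /= /andP[/eqP].
Qed.

End Nonfrozen.

(** * Extension of isomorphisms *)

Section Extension.
Variables (k : fieldType) (C : lincat k) (I : Type) (e : I -> C).
Variables (N N' : module C).
Hypotheses (gN : generated e N) (cN : cogenerated e N).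
Hypotheses (gN' : generated e N') (cN' : cogenerated e N').
Variable theta : mod_hom (res_mod e N) (res_mod e N').
Hypothesis theta_iso : is_iso theta.

(** The relation that the extension must satisfy: the elements have
    corresponding images over all the objects of the subcategory.  It is
    functional because [N'] is cogenerated, and total because [N] is
    generated. *)
Definition extends_theta x (n : N x) (n' : N' x) :=
  forall u (f : hom (e u) x), theta u (act N f n) = act N' f n'.

Lemma extends_theta_total x (n : N x) : exists n', extends_theta n n'.
Proof.
elim: (gN n) => {n} [|u f m n _ [n' h]].
  by exists 0 => u f; rewrite !act0r linear0.
exists (act N' f (theta u m) + n') => v g.
rewrite -[act N f m]scale1r -[act N' f _]scale1r !act_linr !scale1r.
rewrite raddfD /= h -!actM; congr (_ + _).
exact: (mfun_nat theta (lcomp g f : @hom k (full_subcat e) v u)).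
Qed.

Lemma extends_theta_uniq x (n : N x) n1 n2 :
  extends_theta n n1 -> extends_theta n n2 -> n1 = n2.
Proof.
move=> h1 h2; apply/subr0_eq/cN' => u f.
by rewrite -scaleN1r addrC act_linr -h1 -h2 scaleN1r addNr.
Qed.

Definition extension_fun x (n : N x) : N' x :=
  projT1 (cid (extends_theta_total n)).

Lemma extension_funP x (n : N x) : extends_theta n (extension_fun n).
Proof. exact: (projT2 (cid (extends_theta_total n))). Qed.

Lemma extension_linear x : linear (@extension_fun x).
Proof.
move=> a m n; apply: extends_theta_uniq; first exact: extension_funP.
by move=> u f; rewrite !act_linr -!extension_funP linearP.
Qed.

Lemma extension_nat x y (f : hom x y) n :
  extension_fun (act N f n) = act N' f (extension_fun n).
Proof.
apply: extends_theta_uniq; first exact: extension_funP.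
by move=> u g; rewrite -!actM extension_funP.
Qed.

Definition extension : mod_hom N N' := ModHom extension_linear extension_nat.

Lemma extensionE u (n : N (e u)) : extension (e u) n = theta u n.
Proof.
apply: extends_theta_uniq; first exact: extension_funP.
by move=> v f; apply: (mfun_nat theta (f : @hom k (full_subcat e) v u)).
Qed.

Lemma extension_iso : is_iso extension.
Proof.
move=> x; apply: inj_surj_bijective => [m n h|n'].
  apply/subr0_eq/cN => u f; apply: (bij_inj (theta_iso u)).
  rewrite extension_funP linear0.
  have -> : extension_fun (m - n) = 0.
    by rewrite -scaleN1r addrC extension_linear scaleN1r [X in _ + X]h addNr.
  by rewrite act0r.
elim: (gN' n') => {n'} [|u f m' n' _ [n <-]].
  by exists 0; rewrite linear0.
case: (theta_iso u) => inv invK invK'.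
exists (act N f (inv m') + n).
rewrite raddfD; congr (_ + _); rewrite [LHS]extension_nat; congr act.
by rewrite -[RHS]invK'; apply: extensionE.
Qed.

End Extension.

(** * Dimension vectors and realization *)

Section DimensionVectors.
Variable Q0 : finType.

Definition level_bounded (B : nat) (d : rvertex Q0 -> nat) : Prop :=
  forall u, (B < `|level u|)%N -> d u = 0%N.

Lemma dimvec_bounded (w : dimvec Q0) : exists B, level_bounded B w.
Proof.
exists (\max_(u <- finsupp w) `|level u|%N)%N => u.
case: finsuppP => // hu; rewrite ltnNge => /negP[].
exact: (@leq_bigmax_seq _ (enum_fset (finsupp w)) xpredT
  (fun u => `|level u|%N)).
Qed.

Lemma bounded_dimvec (B : nat) (d : rvertex Q0 -> nat) :
  level_bounded B d -> exists v : dimvec Q0, forall u, v u = d u.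
Proof.
move=> hd.
pose s := [seq RVertex i (j%:Z - B%:Z) | i <- enum Q0, j <- iota 0 (2 * B).+1].
exists [fsfun u in [fset u in s]%fset => d u | 0%N] => u; rewrite fsfunE !inE.
case: ifP => // /negbT us; rewrite hd //.
rewrite ltnNge; apply: contra us => hu.
apply/allpairsP; exists (base u, absz (level u + B%:Z)%R); split.
- by rewrite mem_enum.
- by rewrite mem_iota /=; lia.
- by rewrite [LHS](_ : u = RVertex (base u) (level u)) //=; congr RVertex; lia.
Qed.

End DimensionVectors.

Section Vertices.
Variables (Q0 : finType) (P : rvertex (Q0 + Q0)%type -> Type).
Variables (a : forall x, P (nonfrozen x)) (b : forall u, P (frozen u)).

Definition vertex_rect x : P x :=
  match base x as c return P (RVertex c (level x)) with
  | inl i => a (RVertex i (level x))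
  | inr i => b (RVertex i (level x))
  end.

End Vertices.

Section BoundedSupport.
Variables (k : fieldType) (Q0 Q1 : finType) (Q : quiver Q0 Q1).
Hypothesis Qacyclic : acyclic Q.
Local Notation R := (RNak k Q).
Local Notation frozenR := (@frozen Q0 : rvertex Q0 -> R).
Variables (N : module R) (w : rvertex Q0 -> nat).
Variable iso : forall u, {linear 'rV[k]_(w u) -> N (frozen u)}.
Hypothesis iso_bij : forall u, bijective (iso u).

Lemma frozen_zero u (n : N (frozen u)) : w u = 0%N -> n = 0.
Proof.
case: (iso_bij u) => g _ gK wu; rewrite -[n]gK.
have -> : g n = 0 by apply/rowP => -[j hj]; exfalso; move: hj; rewrite wu.
by rewrite linear0.
Qed.

Variable B : nat.
Hypothesis wB : level_bounded B w.

(** A morphism does not decrease the level, so that below the support of [w] all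
    morphisms from the support vanish. *)
Lemma cogenerated_low x (n : N x) :
  cogenerated frozenR N -> (level x < - B%:Z)%R -> n = 0.
Proof.
move=> cN xB; apply: cN => u f.
have [h|h] := ltP (level x) (level u).
  by rewrite (hom_level f) ?act0l.
by apply: frozen_zero; apply: wB; lia.
Qed.

Lemma generated_high x (n : N x) :
  generated frozenR N -> (B%:Z < level x)%R -> n = 0.
Proof.
move=> gN xB; elim: (gN x n) => // u f m {}n _ ->; rewrite addr0.
have [h|h] := ltP (level u) (level x).
  by rewrite (hom_level f) ?act0l.
by rewrite (frozen_zero m) ?act0r //; apply: wB; lia.
Qed.

(** For [x] non frozen, every path from a frozen vertex to [x] ends with an
    arrow.  So an element that is annihilated by the finitely many arrows ending
    at [x] is zero, and these arrows embed [N x] in a space that is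
    finite-dimensional by induction. *)
Lemma cogenerated_findim : cogenerated frozenR N -> forall x, findim (N x).
Proof.
move=> cN x.
elim/(ascending_ind Qacyclic (l := - B%:Z)): x => [x xB|x IH].
  by apply: findim_trivial => n; apply: cogenerated_low.
case: x IH => [[i|i] p] IH; last exact: findim_codomain (iso_bij (RVertex i p)).
pose b c := rarrow_at p c : rarrow (Q1 + Q0).
pose T := {c | tgt (ZQt Q) (b c) == RVertex (inl i) p}.
have path1 (t : T) : is_path (ZQt Q) (src (ZQt Q) (b (val t)))
    [:: b (val t)] (RVertex (inl i) p).
  by have := valP t => /= ->; rewrite eqxx.
pose restr (t : T) :
    {linear N (RVertex (inl i) p) -> N (src (ZQt Q) (b (val t)))} :=
  HB.pack (act N (path_hom k (QPath (path1 t))))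
    (GRing.isLinear.Build _ _ _ _ _
      (act_linr N (path_hom k (QPath (path1 t))))).
apply: (findim_joint (f := restr)).
  by move=> t; apply: IH; apply/eqP/(valP t).
move=> n /= hn; apply: cN => u f.
elim/hom_path_ind: f => [|a f g hf hg|q]; first by rewrite act0l.
  by rewrite (act_linl N n) hf hg scaler0 addr0.
have /path_last[c [q' [h ->]]] : arrows q != [::].
  by apply/eqP => q0; have := qpathP q; rewrite q0 => /eqP.
rewrite path_hom_cat actM [X in act N _ X](_ : _ = 0) ?act0r //.
have tc : tgt (ZQt Q) c = RVertex (inl i) p by have := h => /= /andP[_ /eqP].
(* The last arrow of the path is one of the arrows indexed by [T]. *)
have [c' ec] := rarrow_atP (framed Q) c.
rewrite [tgt (repetition _) c]tc /= in ec; subst c.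
move/eqP: (tc) => tc'.
have := hn (exist _ c' tc').
by rewrite (_ : QPath (path1 (exist _ c' tc')) = QPath h) //; apply: val_inj.
Qed.

End BoundedSupport.

Section Pullback.
Variables (k : fieldType) (C : lincat k) (V : C -> lmodType k) (K : module C).
Variables (F : forall x, {linear V x -> K x}) (G : forall x, K x -> V x).
Hypothesis FK : forall x, cancel (F x) (@G x).
Hypothesis GK : forall x, cancel (@G x) (F x).

Lemma pullback_linear x : linear (@G x).
Proof.
by move=> a u v; apply: (can_inj (FK (x := x))); rewrite linearP !GK.
Qed.

(** Transport of structure along the bijections [F]. *)
Definition pullback : @mod_on k C V.
Proof.
exists (fun x y f m => G (act K f (F y m))).
- by move=> x y m a f g; rewrite act_linl pullback_linear.
- by move=> x y f a m n; rewrite linearP act_linr pullback_linear.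
- by move=> x m; rewrite act1 FK.
- by move=> x y z f g m; rewrite actM GK.
Defined.

Definition pullback_hom : mod_hom (Module pullback) K.
Proof.
exists (fun x (m : V x) => F x m) => [x|x y f m]; first exact: linearP.
by rewrite /= GK.
Defined.

Lemma pullback_iso : is_iso pullback_hom.
Proof. by move=> x; exact: (Bijective (@FK x) (@GK x)). Qed.

End Pullback.

Section Invariance.
Variables (k : fieldType) (C : lincat k) (I : Type) (e : I -> C).
Variables (N N' : module C) (phi : mod_hom N N').
Hypothesis phi_iso : is_iso phi.

Lemma iso_cogenerated : cogenerated e N' -> cogenerated e N.
Proof.
move=> cN x n hn; apply: (bij_inj (phi_iso x)); rewrite linear0.
by apply: cN => u f; rewrite -mfun_nat hn linear0.
Qed.

Lemma iso_generated : generated e N' -> generated e N.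
Proof.
move=> gN x n; have [n' en] : exists n', n' = phi x n by exists (phi x n).
elim: (gN x n') n en => {n'} [|u f m n' _ IH] n en.
  have -> : n = 0 by apply: (bij_inj (phi_iso x)); rewrite -en linear0.
  exact: span_from0.
case: (phi_iso (e u)) => g _ gK.
have -> : n = act N f (g m) + (n - act N f (g m)) by rewrite addrC subrK.
apply/span_from_add/IH.
by rewrite raddfB /= mfun_nat gK -en addrC addKr.
Qed.

End Invariance.

(** * Regular points *)

Section RegularPoints.
Variables (k : fieldType) (Q0 Q1 : finType) (Q : quiver Q0 Q1).
Hypothesis Qacyclic : acyclic Q.
Local Notation R := (RNak k Q).
Local Notation frozenR := (@frozen Q0 : rvertex Q0 -> R).
Variable w : dimvec Q0.

(** The structure of [K] is transported along bijections with row spaces; at the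
    frozen vertices these are given by [i], so that the restriction is [M] on
    the nose. *)
Lemma realization (M : M0 k Q w) (K : module R)
    (i : mod_hom (M0_mod M) (resRS k Q K)) :
  is_iso i -> generated frozenR K -> cogenerated frozenR K ->
  exists (v : dimvec Q0) (N : Mtilde k Q v w),
    [/\ point_of i (Mclass N), costable (mt_mod N) & res_M0 N = M].
Proof.
move=> ibij gK cK.
pose iso u : {linear 'rV[k]_(w u) -> K (frozen u)} :=
  (i u : {linear M0_mod M u -> res_mod frozenR K u}).
have isoP u : bijective (iso u) by exact: ibij.
have [B wB] := dimvec_bounded w.
have fK := cogenerated_findim Qacyclic isoP wB cK.
pose dK x := projT1 (cid (findim_basis (fK x))).
pose fr x : {linear 'rV[k]_(dK x) -> K x} :=
  projT1 (cid (projT2 (cid (findim_basis (fK x))))).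
have frP x : bijective (fr x) :=
  projT2 (cid (projT2 (cid (findim_basis (fK x))))).
have dK0 : level_bounded B (fun x => dK (nonfrozen x)).
  move=> x xB.
  have K0 (n : K (nonfrozen x)) : n = 0.
    have [lx|lx] := ltP (level x) 0.
      by apply: (cogenerated_low isoP wB n cK) => /=; lia.
    by apply: (generated_high isoP wB n gK) => /=; lia.
  apply/eqP; rewrite -leqn0 leqNgt; apply/negP => d0.
  have := bij_inj (frP (nonfrozen x))
    (etrans (K0 (fr _ (const_mx 1))) (esym (K0 (fr _ 0)))).
  by move=> /rowP/(_ (Ordinal d0)); rewrite !mxE => /eqP; rewrite oner_eq0.
have [v vK] := bounded_dimvec dK0.
have nf x : {F : {linear 'rV[k]_(v x) -> K (nonfrozen x)} | bijective F}.
  by rewrite vK; exists (fr (nonfrozen x)); apply: frP.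
(* The values at the frozen vertices must compute to [i]. *)
pose Fs := @vertex_rect Q0
  (fun x => {F : {linear RSpace k v w x -> K x} | bijective F})
  nf (fun u =>
    exist (fun F : {linear _ -> _} => bijective F) (iso u) (isoP u)).
pose F x := projT1 (Fs x).
have Gex x : exists g, cancel (F x) g /\ cancel g (F x).
  by case: (projT2 (Fs x)) => g; exists g.
pose G x := projT1 (cid (Gex x)).
have FK x : cancel (F x) (G x) by case: (projT2 (cid (Gex x))).
have GK x : cancel (G x) (F x) by case: (projT2 (cid (Gex x))).
pose N0 := @pullback k R (RSpace k v w) K F G FK GK.
pose phi : mod_hom (Module N0) K :=
  @pullback_hom k R (RSpace k v w) K F G FK GK.
have phi_iso : is_iso phi by apply: pullback_iso.
have sN : stable (Module N0).
  exact/cogenerated_stable/(iso_cogenerated phi_iso).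
exists v, (MTilde sN); split.
- by exists (MTilde sN) => //; exists phi.
- exact/generated_costable/(iso_generated phi_iso).
- apply: mod_on_eq => x y f m.
  apply: (bij_inj (isoP x)).
  rewrite [RHS](mfun_nat i f m).
  exact: (mfun_nat phi (f : @hom k R (frozen x) (frozen y)) m).
Qed.

Section Regular.
Variable v : dimvec Q0.
Variable N : Mtilde k Q v w.

Lemma RSpace_bounded : exists B, forall x,
  (B < `|level x|)%N -> rdim v w x = 0%N.
Proof.
have [Bv hv] := dimvec_bounded v; have [Bw hw] := dimvec_bounded w.
by exists (maxn Bv Bw) => -[[i|i] p] /= h; [apply: hv|apply: hw] => /=; lia.
Qed.

Lemma Mtilde_cogenerated : cogenerated frozenR (mt_mod N).
Proof.
have [B hB] := RSpace_bounded.
apply: (stable_cogenerated Qacyclic (l := - B%:Z)); last exact: mt_stable.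
move=> x xB n; have d0 : rdim v w x = 0%N by apply: hB; lia.
by apply/rowP => -[j hj]; exfalso; move: hj; rewrite d0.
Qed.

Lemma Mtilde_generated : costable (mt_mod N) -> generated frozenR (mt_mod N).
Proof.
have [B hB] := RSpace_bounded.
apply: (costable_generated Qacyclic (l := B%:Z)) => x xB.
by apply: hB; lia.
Qed.

End Regular.

(** Both modules are generated and cogenerated, and the identity is an
    isomorphism of their restrictions. *)
Lemma regular_iso v v' (N : Mtilde k Q v w) (N' : Mtilde k Q v' w) :
  costable (mt_mod N) -> costable (mt_mod N') -> res_M0 N = res_M0 N' ->
  exists2 phi : mod_hom (mt_mod N) (mt_mod N'), is_iso phi &
    forall u (m : 'rV[k]_(w u)), phi (frozen u) m = m.
Proof.
move=> cN cN' eM.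
pose id_fun (u : rvertex Q0) (m : 'rV[k]_(w u)) := m.
have id_nat x y f m :
    id_fun x (act (res_M0 N) f m) = act (res_M0 N') f (id_fun y m).
  by rewrite eM.
pose rN := res_mod frozenR (mt_mod N).
pose rN' := res_mod frozenR (mt_mod N').
pose theta : mod_hom rN rN' :=
  @ModHom k (SNak k Q) rN rN' id_fun (fun u a m n => erefl) id_nat.
have theta_iso : is_iso theta by move=> u; exists id.
exists (extension (Mtilde_generated cN) (Mtilde_cogenerated (N := N')) theta).
  apply: extension_iso => //; first exact: Mtilde_cogenerated.
  exact: Mtilde_generated.
by move=> u m; apply: extensionE.
Qed.

Lemma regular_dim v v' (N : Mtilde k Q v w) (N' : Mtilde k Q v' w) :
  costable (mt_mod N) -> costable (mt_mod N') -> res_M0 N = res_M0 N' -> v = v'.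
Proof.
move=> cN cN' eM; have [phi phi_iso _] := regular_iso cN cN' eM.
apply/fsfunP => x.
pose f : {linear 'rV[k]_(v x) -> 'rV[k]_(v' x)} :=
  (phi (nonfrozen x) :
     {linear mt_mod N (nonfrozen x) -> mt_mod N' (nonfrozen x)}).
have bf : bijective f := phi_iso (nonfrozen x).
exact: rV_bijective_dim bf.
Qed.

(** The matrices of the isomorphism at the non frozen vertices form an element
    of [G_v], as the isomorphism is the identity at the frozen ones. *)
Lemma regular_orbit v (N N' : Mtilde k Q v w) :
  costable (mt_mod N) -> costable (mt_mod N') -> res_M0 N = res_M0 N' ->
  Mclass N = Mclass N'.
Proof.
move=> cN cN' eM; have [phi phi_iso phi_fr] := regular_iso cN cN' eM.
apply/eqmodP/asboolP.
pose phil x : {linear 'rV[k]_(v x) -> 'rV[k]_(v x)} :=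
  (phi (nonfrozen x) :
     {linear mt_mod N (nonfrozen x) -> mt_mod N' (nonfrozen x)}).
exists (fun x => lin1_mx (phil x)); split=> [x|].
  rewrite -row_free_unit; apply/inj_row_free => u; rewrite mul_rV_lin1 => hu.
  by apply: (bij_inj (phi_iso (nonfrozen x))); rewrite linear0.
have gE x m : m *m extend_gl w (fun x => lin1_mx (phil x)) x = phi x m.
  case: x m => [[i|i] p] m; first exact: (mul_rV_lin1 (phil (RVertex i p))).
  by rewrite [RHS](phi_fr (RVertex i p)); apply: mulmx1.
move=> x y f m; rewrite [X in act _ f X](gE y) [RHS](gE x).
by rewrite [RHS]mfun_nat.
Qed.

Lemma Mreg_class v (O : Mvar k Q v w) : Mreg O ->
  exists N : Mtilde k Q v w,
    [/\ costable (mt_mod N), O = Mclass N & pi_M0 O = res_M0 N].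
Proof. by case=> N cN ->; exists N; rewrite pi_M0E. Qed.

End RegularPoints.

Theorem proposition2p11 (R : realType) (Q0 Q1 : finType) (Q : quiver Q0 Q1)
    (Qacyclic : acyclic Q)
    (KL KR : functor (Mod (SNak R[i] Q)) (Mod (RNak R[i] Q)))
    (adjL : adjunction KL (resRS R[i] Q))
    (adjR : adjunction (resRS R[i] Q) KR)
    (w : dimvec Q0) (M : M0 R[i] Q w) :
  let K := KLR adjL adjR (M0_mod M) in
  stable K /\ costable K /\
  exists (v : dimvec Q0) (Mt : Mvar R[i] Q v w),
    point_of (KLR_unit adjL adjR (M0_mod M)) Mt /\
    Mreg Mt /\
    (is_stratum (reg_image R[i] Q v w) /\ reg_image R[i] Q v w M /\
     forall X, is_stratum X -> X M -> X = reg_image R[i] Q v w) /\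
    (pi_M0 Mt = M /\
     forall O : Mvar R[i] Q v w, Mreg O -> pi_M0 O = M -> O = Mt).
Proof.
move=> K.
have gK : generated (@frozen Q0 : rvertex Q0 -> RNak R[i] Q) K.
  exact: KLR_generated.
have cK : cogenerated (@frozen Q0 : rvertex Q0 -> RNak R[i] Q) K.
  exact: KLR_cogenerated.
split; first exact: cogenerated_stable.
split; first exact: generated_costable.
have iso : is_iso (KLR_unit adjL adjR (M0_mod M) :
    mod_hom (M0_mod M) (resRS _ Q K)).
  exact: KLR_unit_bij.
have [v [N [pN cN eN]]] := realization Qacyclic iso gK cK.
have regN : Mreg (Mclass N) by exists N.
have piN : pi_M0 (Mclass N) = M by rewrite pi_M0E.
have imN : reg_image R[i] Q v w M by exists (Mclass N).
exists v, (Mclass N); split=> //; split=> //; split; last first.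
  split=> // O /Mreg_class[N' [cN' -> ->]] eN'.
  by apply: regular_orbit => //; rewrite eN' eN.
split; first by split; [exists M | exists v].
split=> // X [_ [v' ->]] [O /Mreg_class[N' [cN' _ ->]] eN'].
by rewrite (@regular_dim _ _ _ _ Qacyclic _ _ _ N' N) // eN' eN.
Qed.
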